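(* Let $(W,S)$ be a Coxeter system with finite generating set $S=\{s_1,\dots,s_N\}$ and Coxeter matrix $(m_{ij})_{1\le i,j\le N}$. Let $A$ be the free product over $\mathbb{Q}$ (coproduct of unital associative $\mathbb{Q}$-algebras) of the following algebras: for each pair $i<j$ with $3\le m_{ij}<\infty$, one copy of the Laurent polynomial ring $\mathbb{Q}[x,x^{-1}]$ and one copy of the field $\mathbb{Q}[t]/\langle C_{m_{ij}}(t)\rangle$; and for each pair $i<j$ with $m_{ij}=\infty$, two copies of the polynomial ring $\mathbb{Q}[x]$ in one variable. Then there is an injective (not necessarily unital) ring homomorphism $R_{W,S}\to M_{N+1}(A)$ into the ring of $(N+1)\times(N+1)$ matrices over $A$.
   Context: A Coxeter matrix has $m_{ii}=1$ and $m_{ij}=m_{ji}\in\{2,3,\dots\}\cup\{\infty\}$ for $i\neq j$; $W=\langle s_i\mid (s_ks_l)^{m_{kl}}=1 \text{ whenever } m_{kl}\neq\infty\rangle$. The graph $\Gamma_{W,S}$ has vertex set $S$ and one directed edge $y_{ij}=[s_is_j]$ (origin $s_i$, terminus $s_j$) for each ordered pair $i\ne j$ with $m_{ij}\geq 3$ (including $m_{ij}=\infty$); write $\bar y_{ij}=y_{ji}$. The path algebra $P_{W,S}=\mathbb{Z}\Gamma_{W,S}$ is the free $\mathbb{Z}$-module on all finite directed paths (including the length-$0$ paths $[s]$, $s\in S$), with multiplication given by concatenation when the terminus of the first path equals the origin of the second, and $0$ otherwise. For an integer $m\geq 3$ let $C_m(t)\in\mathbb{Z}[t]$ be the (monic)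 minimal polynomial of $4\cos^2(\pi/m)$ over $\mathbb{Q}$. For each edge $y_{ij}$ with $3\le m_{ij}<\infty$ put $C_{y_{ij}}=C_{m_{ij}}(y_{ij}\bar y_{ij})$, evaluated in the ring $[s_i]P_{W,S}[s_i]$ with identity $[s_i]$ (so the constant term is multiplied by $[s_i]$). Let $I_{W,S}$ be the two-sided ideal of $P_{W,S}$ generated by all $C_{y_{ij}}$ with $3\le m_{ij}<\infty$, and $R_{W,S}=P_{W,S}/I_{W,S}$. *)

(* Defs.v *)
From HB Require Import structures.
From Stdlib Require Import Reals.
From mathcomp Require Import all_boot all_order all_algebra.
From mathcomp Require Import boolp classical_sets Rstruct.
From mathcomp Require Import finmap generic_quotient qpoly ring.
(* The notations of monalg clash with those of mathcomp-analysis: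
   [malg K G] is {malg G[K]}, [mkmalgU k c] is << c *g k >> and
   [mcoeff k g] is g@_k. *)
From mathcomp Require Import -(notations) monalg.

Set Implicit Arguments.
Unset Strict Implicit.
Unset Printing Implicit Defensive.

Import GRing.Theory Num.Theory.
Local Open Scope ring_scope.

(* The set of arrows of a category with finitely many objects, composition
   being written in diagrammatic order.  The value of [cmp x y] is irrelevant
   unless [cod x = dom y]. *)
HB.mixin Record isFinObjCat K of Choice K := {
  ob : finType;
  dom : K -> ob;
  cod : K -> ob;
  idm : ob -> K;
  cmp : K -> K -> K;
  dom_idm : forall o, dom (idm o) = o;
  cod_idm : forall o, cod (idm o) = o;
  dom_cmp : forall x y, cod x = dom y -> dom (cmp x y) = dom x;
  cod_cmp : forall x y, cod x = dom y -> cod (cmp x y) = cod y;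
  cmpA : forall x y z, cod x = dom y -> cod y = dom z ->
    cmp x (cmp y z) = cmp (cmp x y) z;
  cmp1m : forall x, cmp (idm (dom x)) x = x;
  cmpm1 : forall x, cmp x (idm (cod x)) = x
}.

#[short(type="finObjCatType")]
HB.structure Definition FinObjCat := { K of Choice K & isFinObjCat K }.
Arguments ob : clear implicits.

Definition catalg (R : comNzRingType) (K : finObjCatType) := malg K R.

HB.instance Definition _ R K := GRing.Lmodule.on (catalg R K).

Section CatAlgebra.
Variables (R : comNzRingType) (K : finObjCatType).
Implicit Types (g : catalg R K) (x y : K) (a b c : R).

Definition cata x : catalg R K := mkmalgU x 1.

Definition cat_term a x b y : catalg R K :=
  if cod x == dom y then mkmalgU (cmp x y) (a * b) else 0.

Definition cat_mul g1 g2 : catalg R K :=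
  \sum_(x <- msupp g1) \sum_(y <- msupp g2)
    cat_term (mcoeff x g1) x (mcoeff y g2) y.

Definition cat_one : catalg R K := \sum_(o : ob K) cata (idm o).

Lemma cat_term0l x b y : cat_term 0 x b y = 0.
Proof. by rewrite /cat_term mul0r monalgU0 if_same. Qed.

Lemma cat_term0r a x y : cat_term a x 0 y = 0.
Proof. by rewrite /cat_term mulr0 monalgU0 if_same. Qed.

Lemma cat_termDl a1 a2 x b y :
  cat_term (a1 + a2) x b y = cat_term a1 x b y + cat_term a2 x b y.
Proof. by rewrite /cat_term mulrDl monalgUD; case: ifP; rewrite ?addr0. Qed.

Lemma cat_termDr a x b1 b2 y :
  cat_term a x (b1 + b2) y = cat_term a x b1 y + cat_term a x b2 y.
Proof. by rewrite /cat_term mulrDr monalgUD; case: ifP; rewrite ?addr0. Qed.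

Lemma cat_mulw (d1 d2 : {fset K}) g1 g2 :
  (msupp g1 `<=` d1)%fset -> (msupp g2 `<=` d2)%fset ->
  cat_mul g1 g2 = \sum_(x <- d1) \sum_(y <- d2)
    cat_term (mcoeff x g1) x (mcoeff y g2) y.
Proof.
move=> le1 le2; rewrite /cat_mul (big_fset_incl _ le1) /=.
  apply/eq_bigr => x _; apply/big_fset_incl => // y _ /mcoeff_outdom ->.
  by rewrite cat_term0r.
by move=> x _ /mcoeff_outdom ->; rewrite big1 // => y _; rewrite cat_term0l.
Qed.

Lemma cat_mulDl : left_distributive cat_mul +%R.
Proof.
move=> g1 g2 g.
rewrite (cat_mulw (msuppD_le _ _) (fsubset_refl _)).
rewrite (cat_mulw (fsubsetUl _ (msupp g2)) (fsubset_refl _)).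
rewrite (cat_mulw (fsubsetUr (msupp g1) _) (fsubset_refl _)).
rewrite -big_split; apply/eq_bigr => x _ /=.
by rewrite -big_split; apply/eq_bigr => y _ /=; rewrite mcoeffD cat_termDl.
Qed.

Lemma cat_mulDr : right_distributive cat_mul +%R.
Proof.
move=> g g1 g2.
rewrite (cat_mulw (fsubset_refl _) (msuppD_le _ _)).
rewrite (cat_mulw (fsubset_refl _) (fsubsetUl _ (msupp g2))).
rewrite (cat_mulw (fsubset_refl _) (fsubsetUr (msupp g1) _)).
rewrite -big_split; apply/eq_bigr => x _ /=.
by rewrite -big_split; apply/eq_bigr => y _ /=; rewrite mcoeffD cat_termDr.
Qed.

Lemma cat_mul0l : left_zero 0 cat_mul.
Proof. by move=> g; rewrite /cat_mul msupp0 big_seq_fset0. Qed.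

Lemma cat_mul0r : right_zero 0 cat_mul.
Proof.
by move=> g; rewrite /cat_mul big1 // => x _; rewrite msupp0 big_seq_fset0.
Qed.

Lemma cat_mulUU a x b y :
  cat_mul (mkmalgU x a) (mkmalgU y b) = cat_term a x b y.
Proof. by rewrite (cat_mulw msuppU_le msuppU_le) !big_seq_fset1 !mcoeffUU. Qed.

Lemma cat_mul_suml I (r : seq I) (F : I -> catalg R K) g :
  cat_mul (\sum_(i <- r) F i) g = \sum_(i <- r) cat_mul (F i) g.
Proof.
exact: (big_morph (cat_mul^~ g) (fun _ _ => cat_mulDl _ _ _) (cat_mul0l g)).
Qed.

Lemma cat_mul_sumr I (r : seq I) (F : I -> catalg R K) g :
  cat_mul g (\sum_(i <- r) F i) = \sum_(i <- r) cat_mul g (F i).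
Proof.
exact: (big_morph (cat_mul g) (fun _ _ => cat_mulDr _ _ _) (cat_mul0r g)).
Qed.

Lemma cat_mulA : associative cat_mul.
Proof.
move=> g1 g2 g3.
rewrite [g1]monalgE [g2]monalgE [g3]monalgE.
rewrite [LHS]cat_mul_suml (cat_mul_suml (msupp g1)) [RHS]cat_mul_suml.
apply: eq_bigr => x _.
rewrite (cat_mul_suml (msupp g2)) [LHS]cat_mul_sumr.
rewrite (cat_mul_sumr (msupp g2)) [RHS]cat_mul_suml.
apply: eq_bigr => y _.
rewrite (cat_mul_sumr (msupp g3)) [LHS]cat_mul_sumr [RHS]cat_mul_sumr.
apply: eq_bigr => z _.
rewrite !cat_mulUU /cat_term.
have [xy|xy] := eqVneq (cod x) (dom y); last first.
  rewrite cat_mul0l; case: ifP => [/eqP yz|_]; last by rewrite cat_mul0r.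
  by rewrite cat_mulUU /cat_term dom_cmp // (negPf xy).
have [yz|yz] := eqVneq (cod y) (dom z); last first.
  by rewrite cat_mul0r cat_mulUU /cat_term cod_cmp // (negPf yz).
by rewrite !cat_mulUU /cat_term dom_cmp // cod_cmp // xy yz !eqxx mulrA cmpA.
Qed.

Lemma cat_mul1l : left_id cat_one cat_mul.
Proof.
move=> g; rewrite [g]monalgE cat_mul_sumr; apply: eq_bigr => x _.
rewrite cat_mul_suml (bigD1 (dom x)) //= big1 ?addr0 => [|o ne].
  by rewrite cat_mulUU /cat_term cod_idm eqxx mul1r cmp1m.
by rewrite cat_mulUU /cat_term cod_idm (negPf ne).
Qed.

Lemma cat_mul1r : right_id cat_one cat_mul.
Proof.
move=> g; rewrite [g]monalgE cat_mul_suml; apply: eq_bigr => x _.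
rewrite cat_mul_sumr (bigD1 (cod x)) //= big1 ?addr0 => [|o ne].
  by rewrite cat_mulUU /cat_term dom_idm eqxx mulr1 cmpm1.
by rewrite cat_mulUU /cat_term dom_idm eq_sym (negPf ne).
Qed.

HB.instance Definition _ := GRing.Zmodule_isPzRing.Build (catalg R K)
  cat_mulA cat_mul1l cat_mul1r cat_mulDl cat_mulDr.

Lemma cataM x y :
  cata x * cata y = if cod x == dom y then cata (cmp x y) else 0.
Proof. by rewrite [LHS]cat_mulUU /cat_term mulr1. Qed.

Lemma cata1 : 1 = \sum_(o : ob K) cata (idm o). Proof. by []. Qed.

Lemma mkmalgU_scale c x : mkmalgU x c = c *: cata x :> catalg R K.
Proof. by apply/malgP => k; rewrite mcoeffZ !mcoeffU mulrnAr mulr1. Qed.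

Lemma cata_sum g : g = \sum_(x <- msupp g) mcoeff x g *: cata x.
Proof.
by rewrite [LHS]monalgE; apply: eq_bigr => x _; rewrite mkmalgU_scale.
Qed.

Lemma cat_scaleAl c g1 g2 : c *: (g1 * g2) = (c *: g1) * g2.
Proof.
rewrite [RHS](cat_mulw (msuppZ_le _ _) (fsubset_refl _)) scaler_sumr.
apply: eq_bigr => x _; rewrite scaler_sumr; apply: eq_bigr => y _.
rewrite mcoeffZ /cat_term; case: ifP => _; rewrite ?scaler0 //.
by rewrite !mkmalgU_scale scalerA mulrA.
Qed.

Lemma cat_scaleAr c g1 g2 : c *: (g1 * g2) = g1 * (c *: g2).
Proof.
rewrite [RHS](cat_mulw (fsubset_refl _) (msuppZ_le _ _)) scaler_sumr.
apply: eq_bigr => x _; rewrite scaler_sumr; apply: eq_bigr => y _.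
rewrite mcoeffZ /cat_term; case: ifP => _; rewrite ?scaler0 //.
by rewrite !mkmalgU_scale scalerA mulrCA.
Qed.

End CatAlgebra.

Arguments cata {R K} x.

Section RingQuotient.
Variables (P : pzRingType) (G : P -> Prop).

Inductive gen_ideal : P -> Prop :=
| gen_ideal_in x of G x : gen_ideal x
| gen_ideal0 : gen_ideal 0
| gen_idealB x y of gen_ideal x & gen_ideal y : gen_ideal (x - y)
| gen_idealMl a x of gen_ideal x : gen_ideal (a * x)
| gen_idealMr a x of gen_ideal x : gen_ideal (x * a).

Definition gen_ideal_pred : {pred P} := [pred x | `[< gen_ideal x >]].

Lemma gen_ideal_zmod_closed : zmod_closed gen_ideal_pred.
Proof.
split=> [|x y]; first exact/asboolP/gen_ideal0.
by move=> /asboolP Ix /asboolP Iy; apply/asboolP/gen_idealB.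
Qed.

HB.instance Definition _ :=
  GRing.isZmodClosed.Build P gen_ideal_pred gen_ideal_zmod_closed.

Definition ring_quot := Quotient.quot gen_ideal_pred.

HB.instance Definition _ := GRing.Zmodule.on ring_quot.

Definition rq_pi (x : P) : ring_quot := \pi_(Quotient.quot gen_ideal_pred)%qT x.

Lemma rq_piP x y : rq_pi x = rq_pi y <-> gen_ideal (x - y).
Proof.
split=> [/eqP|/asboolP Ixy]; first by rewrite -Quotient.idealrBE => /asboolP.
by apply/eqP; rewrite -Quotient.idealrBE.
Qed.

Lemma rq_piB : {morph rq_pi : x y / x - y}.
Proof. by move=> x y; rewrite /rq_pi !piE. Qed.

HB.instance Definition _ :=
  GRing.isZmodMorphism.Build P ring_quot rq_pi rq_piB.

Lemma rq_reprK : cancel (@repr P (Quotient.quot gen_ideal_pred)) rq_pi.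
Proof. exact: reprK. Qed.

Lemma rq_surj (q : ring_quot) : exists x, q = rq_pi x.
Proof. by exists (repr q); rewrite rq_reprK. Qed.

Definition rq_mul (p q : ring_quot) : ring_quot := rq_pi (repr p * repr q).

Lemma rq_pi_mul : {morph rq_pi : x y / x * y >-> rq_mul x y}.
Proof.
move=> x y; apply/rq_piP.
have /rq_piP Ix : rq_pi x = rq_pi (repr (rq_pi x)) by rewrite rq_reprK.
have /rq_piP Iy : rq_pi y = rq_pi (repr (rq_pi y)) by rewrite rq_reprK.
set x' := repr (rq_pi x) in Ix *; set y' := repr (rq_pi y) in Iy *.
have -> : x * y - x' * y' = (x - x') * y - x' * (y' - y).
  by rewrite mulrBl mulrBr opprB addrA subrK.
apply: gen_idealB; first exact: gen_idealMr.
by apply: gen_idealMl; rewrite -opprB -sub0r; apply/gen_idealB/Iy/gen_ideal0.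
Qed.

Lemma rq_mulA : associative rq_mul.
Proof.
move=> p q r; have [[[x ->] [y ->]] [z ->]] := (rq_surj p, rq_surj q, rq_surj r).
by rewrite -!rq_pi_mul mulrA.
Qed.

Lemma rq_mul1l : left_id (rq_pi 1) rq_mul.
Proof. by move=> p; have [x ->] := rq_surj p; rewrite -rq_pi_mul mul1r. Qed.

Lemma rq_mul1r : right_id (rq_pi 1) rq_mul.
Proof. by move=> p; have [x ->] := rq_surj p; rewrite -rq_pi_mul mulr1. Qed.

Lemma rq_mulDl : left_distributive rq_mul +%R.
Proof.
move=> p q r; have [[[x ->] [y ->]] [z ->]] := (rq_surj p, rq_surj q, rq_surj r).
by rewrite -!(raddfD, rq_pi_mul) mulrDl.
Qed.

Lemma rq_mulDr : right_distributive rq_mul +%R.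
Proof.
move=> p q r; have [[[x ->] [y ->]] [z ->]] := (rq_surj p, rq_surj q, rq_surj r).
by rewrite -!(raddfD, rq_pi_mul) mulrDr.
Qed.

HB.instance Definition _ := GRing.Zmodule_isPzRing.Build ring_quot
  rq_mulA rq_mul1l rq_mul1r rq_mulDl rq_mulDr.

Lemma rq_pi_monoid_morphism : monoid_morphism rq_pi.
Proof. by split=> // x y; rewrite rq_pi_mul. Qed.

HB.instance Definition _ :=
  GRing.isMonoidMorphism.Build P ring_quot rq_pi rq_pi_monoid_morphism.

End RingQuotient.

(* A quotient of a category algebra is again an algebra, since its ideals are
   stable under scaling. *)
Section CatAlgebraQuotient.
Variables (R : comNzRingType) (K : finObjCatType) (G : catalg R K -> Prop).
Local Notation Q := (ring_quot G).

Definition rq_scale (c : R) (q : Q) : Q := rq_pi G (c *: (1 : catalg R K)) * q.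

Lemma rq_pi_scale c (x : catalg R K) : rq_pi G (c *: x) = rq_scale c (rq_pi G x).
Proof. by rewrite /rq_scale -rmorphM -cat_scaleAl mul1r. Qed.

Lemma rq_scaleA a b q : rq_scale a (rq_scale b q) = rq_scale (a * b) q.
Proof. by have [x ->] := rq_surj q; rewrite -!rq_pi_scale scalerA. Qed.

Lemma rq_scale1 : left_id 1 rq_scale.
Proof. by move=> q; have [x ->] := rq_surj q; rewrite -rq_pi_scale scale1r. Qed.

Lemma rq_scaleDr : right_distributive rq_scale +%R.
Proof. by move=> a p q; rewrite /rq_scale mulrDr. Qed.

Lemma rq_scaleDl q : {morph rq_scale^~ q : a b / a + b}.
Proof. by move=> a b; rewrite /rq_scale scalerDl rmorphD mulrDl. Qed.

HB.instance Definition _ := GRing.Zmodule_isLmodule.Build R (ring_quot G)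
  rq_scaleA rq_scale1 rq_scaleDr rq_scaleDl.

Lemma rq_piZ c (x : catalg R K) : rq_pi G (c *: x) = c *: rq_pi G x.
Proof. exact: rq_pi_scale. Qed.

Lemma rq_scaleAl c (p q : Q) : c *: (p * q) = (c *: p) * q.
Proof. by rewrite [LHS]mulrA. Qed.

Lemma rq_scaleAr c (p q : Q) : c *: (p * q) = p * (c *: q).
Proof.
have [[x ->] [y ->]] := (rq_surj p, rq_surj q).
by rewrite -rmorphM -!rq_piZ -rmorphM cat_scaleAr.
Qed.

End CatAlgebraQuotient.

Definition zexp : Type := int.
HB.instance Definition _ := Choice.on zexp.

Fact zexp_addA (x y z : zexp) : tt = tt -> tt = tt ->
  (x + (y + z) : int) = (x + y) + z.
Proof. by rewrite addrA. Qed.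

HB.instance Definition _ := @isFinObjCat.Build zexp unit
  (fun=> tt) (fun=> tt) (fun=> 0 : int) (fun x y => (x : int) + (y : int))
  (fun o => let: tt := o in erefl) (fun o => let: tt := o in erefl)
  (fun _ _ _ => erefl) (fun _ _ _ => erefl)
  zexp_addA (@add0r int) (@addr0 int).

(* The group algebra of Z: the basis vector [cata n] is the monomial x^n. *)
Definition laurent := catalg rat zexp.

HB.instance Definition _ := GRing.PzRing.on laurent.
HB.instance Definition _ := GRing.Lmodule.on laurent.

Lemma laurent1_neq0 : (1 : laurent) != 0.
Proof.
apply/eqP => /malgP/(_ 0)/eqP.
by rewrite cata1 raddf_sum (bigD1 tt) //= big1 ?mcoeffU ?mcoeff0 // => -[].
Qed.

HB.instance Definition _ :=
  GRing.PzSemiRing_isNonZero.Build laurent laurent1_neq0.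
HB.instance Definition _ :=
  GRing.Lmodule_isLalgebra.Build rat laurent (@cat_scaleAl rat zexp).
HB.instance Definition _ :=
  GRing.Lalgebra_isAlgebra.Build rat laurent (@cat_scaleAr rat zexp).

(* Words in T, as the arrows of a category with one object; [free_alg R T]
   is the free associative R-algebra on T. *)
Definition words (T : choiceType) : Type := seq T.
HB.instance Definition _ T := Choice.on (words T).

HB.instance Definition _ (T : choiceType) :=
  @isFinObjCat.Build (words T) unit
  (fun=> tt) (fun=> tt) (fun=> [::]) (fun x y => x ++ y)
  (fun o => let: tt := o in erefl) (fun o => let: tt := o in erefl)
  (fun _ _ _ => erefl) (fun _ _ _ => erefl)
  (fun x y z _ _ => catA x y z) (@cat0s T) (@cats0 T).

Definition free_alg (R : comNzRingType) (T : choiceType) :=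
  catalg R (words T).

HB.instance Definition _ R T := GRing.PzRing.on (free_alg R T).
HB.instance Definition _ R T := GRing.Lmodule.on (free_alg R T).

Definition free_gen R (T : choiceType) (t : T) : free_alg R T :=
  cata ([:: t] : words T).

Section Coproduct.
Variables (R : comNzRingType) (I : choiceType) (B : I -> algType R).

Definition cop_gen k (b : B k) : free_alg R {k : I & B k} :=
  free_gen R (Tagged B b).

(* The relations making every b |-> [cop_gen b] a morphism of unital
   R-algebras; [coprod_lift] and [coprod_ext] state the universal property of
   the resulting quotient. *)
Inductive coprod_rel : free_alg R {k : I & B k} -> Prop :=
| coprod_rel1 k : coprod_rel (cop_gen (1 : B k) - 1)
| coprod_relM k (a b : B k) :
    coprod_rel (cop_gen (a * b) - cop_gen a * cop_gen b)
| coprod_relL k c (a b : B k) :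
    coprod_rel (cop_gen (c *: a + b) - (c *: cop_gen a + cop_gen b)).

Definition coprod := ring_quot coprod_rel.

HB.instance Definition _ := GRing.PzRing.on coprod.
HB.instance Definition _ := GRing.Lmodule.on coprod.

Definition coprod_in k (b : B k) : coprod := rq_pi coprod_rel (cop_gen b).

Lemma coprod_in_linear k : linear (@coprod_in k).
Proof.
move=> c a b; rewrite /coprod_in -rq_piZ -raddfD.
by apply/rq_piP/gen_ideal_in/coprod_relL.
Qed.

Lemma coprod_in_monoid k : monoid_morphism (@coprod_in k).
Proof.
split=> [|a b]; rewrite /coprod_in -?rmorphM -?(rmorph1 (rq_pi _)).
  exact/rq_piP/gen_ideal_in/coprod_rel1.
exact/rq_piP/gen_ideal_in/coprod_relM.
Qed.

HB.instance Definition _ k :=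
  GRing.isLinear.Build R (B k) coprod _ (@coprod_in k) (@coprod_in_linear k).
HB.instance Definition _ k := GRing.isMonoidMorphism.Build
  (B k) coprod (@coprod_in k) (@coprod_in_monoid k).

End Coproduct.

Section FreeAlgebraLift.
Variables (R : comNzRingType) (T : choiceType) (C : algType R) (h : T -> C).

Definition free_lift (g : free_alg R T) : C :=
  mmap (in_alg C) (fun w : words T => \prod_(t <- w) h t) g.

Lemma free_liftB : {morph free_lift : x y / x - y}.
Proof. exact: mmapB. Qed.

HB.instance Definition _ :=
  GRing.isZmodMorphism.Build (free_alg R T) C free_lift free_liftB.

Lemma free_lift_cata (w : words T) : free_lift (cata w) = \prod_(t <- w) h t.
Proof. by rewrite /free_lift mmapU /= scale1r mul1r. Qed.

Lemma free_liftZ c x : free_lift (c *: x) = c *: free_lift x.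
Proof.
rewrite /free_lift (mmapEw (msuppZ_le _ _)) mmapE scaler_sumr.
by apply: eq_bigr => w _; rewrite mcoeffZ /= !mulr_algl scalerA.
Qed.

Lemma free_lift_gen t : free_lift (free_gen R t) = h t.
Proof. by rewrite free_lift_cata big_seq1. Qed.

Lemma free_lift_sum J (r : seq J) (F : J -> free_alg R T) :
  free_lift (\sum_(i <- r) F i) = \sum_(i <- r) free_lift (F i).
Proof. exact: raddf_sum. Qed.

Lemma free_lift_monoid : monoid_morphism free_lift.
Proof.
split=> [|x y].
  rewrite [1]cata1 raddf_sum (bigD1 tt) //= big1 => [|[]//].
  by rewrite addr0 free_lift_cata big_nil.
rewrite [x]cata_sum [y]cata_sum mulr_suml 3!free_lift_sum mulr_suml.
apply: eq_bigr => v _; rewrite mulr_sumr free_lift_sum mulr_sumr.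
apply: eq_bigr => w _; rewrite -cat_scaleAl -cat_scaleAr !free_liftZ.
rewrite cataM eqxx -scalerAl -scalerAr; congr (_ *: (_ *: _)).
by rewrite !free_lift_cata big_cat.
Qed.

HB.instance Definition _ := GRing.isMonoidMorphism.Build
  (free_alg R T) C free_lift free_lift_monoid.

End FreeAlgebraLift.

Section CoproductUniversal.
Variables (R : comNzRingType) (I : choiceType) (B : I -> algType R).
Variables (C : algType R).

Lemma coprod_lift (phi : forall k, {lrmorphism B k -> C}) :
  exists f : {rmorphism coprod B -> C},
    scalable f /\ forall k (b : B k), f (coprod_in b) = phi k b.
Proof.
pose F : {rmorphism free_alg R {k : I & B k} -> C} :=
  free_lift (fun t : {k : I & B k} => phi (tag t) (tagged t)).
have FZ c x : F (c *: x) = c *: F x by exact: free_liftZ.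
have F_gen k (b : B k) : F (cop_gen b) = phi k b by exact: free_lift_gen.
have F0 x : gen_ideal (coprod_rel (B := B)) x -> F x = 0.
  elim=> {x}[_ [k|k a b|k c a b]| |x y _ Fx _ Fy|a x _ Fx|a x _ Fx].
  - by rewrite raddfB /= rmorph1 F_gen rmorph1 subrr.
  - by rewrite raddfB /= rmorphM !F_gen rmorphM subrr.
  - by rewrite raddfB raddfD /= FZ !F_gen linearP subrr.
  - by rewrite raddf0.
  - by rewrite raddfB /= Fx Fy subrr.
  - by rewrite rmorphM /= Fx mulr0.
  - by rewrite rmorphM /= Fx mul0r.
pose f (q : coprod B) : C := F (repr q).
have f_pi x : f (rq_pi _ x) = F x.
  apply/eqP; rewrite -subr_eq0 -raddfB; apply/eqP/F0/rq_piP.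
  by rewrite rq_reprK.
have fB : zmod_morphism f.
  move=> p q; have [[x ->] [y ->]] := (rq_surj p, rq_surj q).
  by rewrite -raddfB !f_pi raddfB.
have fM : monoid_morphism f.
  split=> [|p q]; first by rewrite -(rmorph1 (rq_pi _)) f_pi rmorph1.
  have [[x ->] [y ->]] := (rq_surj p, rq_surj q).
  by rewrite -rmorphM !f_pi rmorphM.
pose fB' := GRing.isZmodMorphism.Build _ _ f fB.
pose fM' := GRing.isMonoidMorphism.Build _ _ f fM.
pose f' : {rmorphism coprod B -> C} := HB.pack f fB' fM'.
exists f'; split=> [c q|k b]; last by rewrite /= f_pi.
by have [x ->] := rq_surj q; rewrite /= -rq_piZ !f_pi FZ.
Qed.

Lemma coprod_ext (f g : {rmorphism coprod B -> C}) :
  scalable f -> scalable g ->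
  (forall k (b : B k), f (coprod_in b) = g (coprod_in b)) -> f =1 g.
Proof.
move=> fZ gZ fg q; have [x ->] := rq_surj q.
rewrite [x]cata_sum raddf_sum /= [LHS]raddf_sum [RHS]raddf_sum.
apply: eq_bigr => w _; rewrite rq_piZ.
apply: etrans (fZ _ _) (etrans _ (esym (gZ _ _))); congr (_ *: _).
elim: w => [|t w IH].
  have -> : cata ([::] : words {k : I & B k}) = 1 :> free_alg R _.
    by rewrite [RHS]cata1 (bigD1 tt) //= big1 ?addr0 // => -[].
  by rewrite !rmorph1.
have -> : cata (t :: w : words _) = free_gen R t * cata (w : words _).
  by rewrite [RHS]cataM.
rewrite !rmorphM IH; congr (_ * _).
by case: t => k b; exact: fg.
Qed.

End CoproductUniversal.

Definition is_min_poly (p : {poly rat}) (a : R) :=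
  [/\ p \is monic, root (map_poly ratr p) a &
      forall q : {poly rat}, root (map_poly ratr q) a -> p %| q].

Definition four_cos2 (m : nat) : R := (4 * cos (PI / m%:R)%R ^+ 2)%R.

Definition ratp (p : {poly int}) : {poly rat} := map_poly intr p.

(* C_m as an element of Z[t]; it is well defined by [cos_polyP] below. *)
Definition cos_poly (m : nat) : {poly int} :=
  xget 0 [set p | is_min_poly (ratp p) (four_cos2 m)].

Section CosPoly.

(* Chebyshev polynomials: [cheb n] takes the value 2 cos (n t) at
   2 + 2 cos t. *)
Fixpoint cheb2 n : {poly int} * {poly int} :=
  if n is n'.+1 then
    let: (p, q) := cheb2 n' in (q, ('X - 2%:P) * q - p)
  else (2%:P, 'X - 2%:P).
Definition cheb n := (cheb2 n).1.

Lemma chebSS n : cheb n.+2 = ('X - 2%:P) * cheb n.+1 - cheb n.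
Proof. by rewrite /cheb /=; case: (cheb2 n). Qed.

Lemma cheb_monic n : [/\ (size (cheb n) <= n.+1)%N,
  cheb n.+1 \is monic & size (cheb n.+1) = n.+2].
Proof.
elim: n => [|n [szn mon sz]].
  have -> : cheb 0 = 2%:P by [].
  have -> : cheb 1 = 'X - 2%:P by [].
  by rewrite size_polyC_leq1 monicXsubC size_XsubC.
have szm : size (('X - 2%:P) * cheb n.+1) = n.+3.
  by rewrite size_monicM ?monicXsubC ?monic_neq0 // size_XsubC sz.
have lt : (size (- cheb n)%R < size (('X - 2%:P) * cheb n.+1)%R)%N.
  by rewrite szm size_polyN (leq_trans _ (leqnSn _)).
rewrite chebSS monicE lead_coefDl // size_polyDl // szm sz; split=> //.
by rewrite -monicE monicMr ?monicXsubC.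
Qed.

Lemma map_ratr_ratp p : map_poly ratr (ratp p) = map_poly intr p :> {poly R}.
Proof. by apply/polyP => i; rewrite !coef_map_id0 ?rmorph0 //= ratr_int. Qed.

Lemma RcosD (x y : R) : cos (x + y)%R = cos x * cos y - sin x * sin y.
Proof. exact: cos_plus. Qed.

Lemma RcosB (x y : R) : cos (x - y)%R = cos x * cos y + sin x * sin y.
Proof. exact: cos_minus. Qed.

Lemma cheb_cos (t : R) n :
  (map_poly intr (cheb n)).[2 + 2 * cos t] = 2 * cos (n%:R * t)%R.
Proof.
have E k : 2 * cos (k.+2%:R * t)%R = ((2 + 2 * cos t) - 2) *
    (2 * cos (k.+1%:R * t)%R) - 2 * cos (k%:R * t)%R.
  have -> : cos (k.+2%:R * t)%R = cos (k.+1%:R * t + t)%R.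
    by congr cos; rewrite -[k.+2]addn1 natrD; ring.
  have -> : cos (k%:R * t)%R = cos (k.+1%:R * t - t)%R.
    by congr cos; rewrite -[k.+1]addn1 natrD; ring.
  by rewrite RcosD RcosB; ring.
pose Q k := (map_poly intr (cheb k)).[2 + 2 * cos t] = 2 * cos (k%:R * t)%R.
suff [] : Q n /\ Q n.+1 by [].
elim: n => [|n [IH0 IH1]].
  split; rewrite /Q.
    by rewrite [cheb 0]/(2%:P) map_polyC hornerC /= mul0r [cos 0]cos_0 mulr1.
  rewrite [cheb 1]/('X - 2%:P) rmorphB /= map_polyX map_polyC.
  by rewrite hornerD hornerN hornerX hornerC /= mul1r addrAC subrr add0r.
split=> //; rewrite /Q chebSS rmorphB rmorphM rmorphB /= map_polyX map_polyC.
by rewrite hornerD hornerN hornerM hornerD hornerN hornerX hornerC IH0 IH1 E.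
Qed.

Lemma cos_int_root m : (0 < m)%N ->
  exists2 q : {poly int}, q \is monic & root (map_poly intr q) (four_cos2 m).
Proof.
case: m => // m _; have [sz mon szS] := cheb_monic m.
have lt : (size (- 2%:P : {poly int})%R < size (cheb m.+1))%N.
  by rewrite szS size_polyN (leq_ltn_trans (size_polyC_leq1 _)).
exists (cheb m.+1 - 2%:P); first by rewrite monicE lead_coefDl.
have -> : four_cos2 m.+1 = 2 + 2 * cos (PI / m.+1%:R + PI / m.+1%:R)%R.
  have sc : sin (PI / m.+1%:R)%R * sin (PI / m.+1%:R)%R =
      1 - cos (PI / m.+1%:R)%R * cos (PI / m.+1%:R)%R.
    by apply/eqP; rewrite eq_sym subr_eq; apply/eqP/esym/sin2_cos2.
  by rewrite RcosD sc /four_cos2; move: (cos _) => c; ring.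
rewrite rmorphB /= map_polyC /root hornerD hornerN hornerC cheb_cos.
have -> : m.+1%:R * (PI / m.+1%:R + PI / m.+1%:R) = 2 * PI :> R.
  by field; rewrite nat1r pnatr_eq0.
by rewrite [cos (2 * PI)%R]cos_2PI mulr1 subrr.
Qed.

Lemma min_poly_int (a : R) (q : {poly int}) :
  q \is monic -> root (map_poly intr q) a ->
  exists p, is_min_poly (ratp p) a.
Proof.
move=> qmon qa.
pose S n := `[< exists p : {poly rat},
  [/\ p != 0, root (map_poly ratr p) a & size p = n] >].
have ratq_mon : ratp q \is monic by apply: monic_map.
have exS : exists n, S n.
  exists (size (ratp q)); apply/asboolP; exists (ratp q).
  by rewrite monic_neq0 // map_ratr_ratp.
case: (ex_minnP exS) => n /asboolP[p0 [p0n0 p0a szp0]] minn.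
pose p := (lead_coef p0)^-1 *: p0.
have lc0 : (lead_coef p0)^-1 != 0 by rewrite invr_eq0 lead_coef_eq0.
have pmon : p \is monic.
  by rewrite monicE lead_coefZ mulVf // lead_coef_eq0.
have pa : root (map_poly ratr p) a.
  by rewrite /p map_polyZ /= rootZ // fmorph_eq0.
have pdvd (r : {poly rat}) : root (map_poly ratr r) a -> p %| r.
  move=> ra; apply/modp_eq0P/eqP/negP => /negP rn0.
  have : S (size (r %% p)).
    apply/asboolP; exists (r %% p); split=> //.
    have : root (map_poly ratr (r %/ p * p + r %% p)) a by rewrite -divp_eq.
    rewrite rmorphD rmorphM /= /root hornerD hornerM.
    by rewrite (eqP (pa : _ == 0)) mulr0 add0r.
  move/minn; rewrite -szp0 -(size_scale p0 lc0) leqNgt.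
  by rewrite ltn_modp monic_neq0.
have [p1 [c c0 pE] [r qE]] := dvdpP_rat_int (pdvd _ (etrans
  (congr1 (fun s => root s a) (map_ratr_ratp q)) qa)).
have lcM : lead_coef p1 * lead_coef r = 1.
  by rewrite -lead_coefM -qE; exact/eqP.
have lc1 : absz (lead_coef p1) = 1%N.
  have /eqP : absz (lead_coef p1 * lead_coef r) = 1%N by rewrite lcM.
  by rewrite abszM muln_eq1 => /andP[/eqP].
have lc2 : lead_coef p1 * lead_coef p1 = 1.
  by rewrite -expr2 -real_normK ?num_real // -abszE lc1.
have cE : c = (lead_coef p1)%:~R.
  have : c * (lead_coef p1)%:~R = 1.
    have := eqP (pmon : lead_coef p == 1); rewrite pE lead_coefZ.
    by rewrite lead_coef_map_inj //; exact: intr_inj.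
  move/(congr1 (fun z => z * (lead_coef p1)%:~R)).
  by rewrite -mulrA -intrM lc2 mulr1 mul1r.
exists (lead_coef p1 *: p1).
by rewrite /ratp map_polyZ /= -cE -pE; split.
Qed.

Lemma cos_polyP m : (0 < m)%N ->
  is_min_poly (ratp (cos_poly m)) (four_cos2 m).
Proof.
move=> /cos_int_root[q qmon qa]; have [p pP] := min_poly_int qmon qa.
by apply: (@xgetPex _ 0 [set p | is_min_poly (ratp p) (four_cos2 m)]); exists p.
Qed.

(* {poly %/ p} is the quotient by [mk_monic p], which differs from p unless p
   is monic and not constant. *)
Lemma mk_monic_cos_poly m : (0 < m)%N ->
  mk_monic (ratp (cos_poly m)) = ratp (cos_poly m).
Proof.
move=> /cos_polyP[mon rt _]; rewrite /mk_monic mon andbT ltnNge.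
case: leqP => //= le1; move: rt mon; rewrite (size1_polyC le1) map_polyC /=.
by rewrite rootC fmorph_eq0 => /eqP ->; rewrite monicE lead_coef0 eq_sym oner_eq0.
Qed.

End CosPoly.

Section Paths.
Variables (V : finType) (e : rel V).

(* A path is given by its origin and the sequence of the vertices that follow;
   this is faithful since there is at most one edge from a vertex to another. *)
Definition dpath : Type := {p : V * seq V | path e p.1 p.2}.
HB.instance Definition _ := Choice.on dpath.

Definition porigin (p : dpath) : V := (val p).1.
Definition pterminus (p : dpath) : V := last (val p).1 (val p).2.
Definition pvertex (v : V) : dpath :=
  exist (fun p : V * seq V => path e p.1 p.2) (v, [::]) isT.
Definition pedge (v w : V) (vw : e v w) : dpath :=
  exist (fun p : V * seq V => path e p.1 p.2) (v, [:: w])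
    (introT andP (conj vw isT)).
Definition pconcat (p q : dpath) : dpath :=
  insubd p ((val p).1, (val p).2 ++ (val q).2).

Lemma val_pconcat p q : pterminus p = porigin q ->
  val (pconcat p q) = ((val p).1, (val p).2 ++ (val q).2).
Proof.
move=> pq; apply: insubdK; rewrite unfold_in /= cat_path (valP p) /=.
by rewrite -[last _ _]/(pterminus p) pq (valP q).
Qed.

Lemma porigin_vertex v : porigin (pvertex v) = v. Proof. by []. Qed.

Lemma pterminus_vertex v : pterminus (pvertex v) = v. Proof. by []. Qed.

Lemma porigin_concat p q : pterminus p = porigin q ->
  porigin (pconcat p q) = porigin p.
Proof. by move=> pq; rewrite /porigin val_pconcat. Qed.

Lemma pterminus_concat p q : pterminus p = porigin q ->
  pterminus (pconcat p q) = pterminus q.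
Proof.
move=> pq; rewrite {1}/pterminus val_pconcat //= last_cat.
by rewrite -[last _ (val p).2]/(pterminus p) pq.
Qed.

Lemma pconcatA p q r : pterminus p = porigin q -> pterminus q = porigin r ->
  pconcat p (pconcat q r) = pconcat (pconcat p q) r.
Proof.
move=> pq qr; apply: val_inj.
have p_qr : pterminus p = porigin (pconcat q r) by rewrite porigin_concat.
have pq_r : pterminus (pconcat p q) = porigin r by rewrite pterminus_concat.
by rewrite (val_pconcat p_qr) (val_pconcat pq_r) (val_pconcat pq) (val_pconcat qr) /= catA.
Qed.

Lemma pconcat1p p : pconcat (pvertex (porigin p)) p = p.
Proof.
by apply: val_inj; rewrite val_pconcat //=; case: p => -[].
Qed.

Lemma pconcatp1 p : pconcat p (pvertex (pterminus p)) = p.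
Proof.
by apply: val_inj; rewrite val_pconcat //= cats0; case: p => -[].
Qed.

HB.instance Definition _ := @isFinObjCat.Build dpath V
  porigin pterminus pvertex pconcat porigin_vertex pterminus_vertex
  porigin_concat pterminus_concat pconcatA pconcat1p pconcatp1.

(* The free Z-module on the paths; by [cataM] the product of two paths is
   their concatenation, or 0 if they do not match. *)
Definition path_alg := catalg int dpath.

HB.instance Definition _ := GRing.PzRing.on path_alg.
HB.instance Definition _ := GRing.Lmodule.on path_alg.

Definition pa_vertex (v : V) : path_alg := cata (pvertex v).

Definition pa_edge (v w : V) (vw : e v w) : path_alg := cata (pedge vw).

(* The value at z of p in the ring [v]P[v], whose identity is [v], for z in
   this ring. *)
Definition corner_eval (v : V) (p : {poly int}) (z : path_alg) : path_alg :=
  \sum_(k < size p) p`_k *: (pa_vertex v * z ^+ k).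

End Paths.

(* [None] stands for infinity. *)
Record coxeter_matrix (N : nat) := CoxeterMatrix {
  cox_entry :> 'I_N -> 'I_N -> option nat;
  cox_diag : forall i, cox_entry i i = Some 1%N;
  cox_sym : forall i j, cox_entry i j = cox_entry j i;
  cox_ge2 : forall i j m, i != j -> cox_entry i j = Some m -> (2 <= m)%N
}.

Section CoxeterRing.
Variables (N : nat) (M : coxeter_matrix N).

Definition cox_edge : rel 'I_N := fun i j =>
  (i != j) && (if M i j is Some m then 3 <= m else true)%N.

Lemma cox_edgeC i j : cox_edge i j -> cox_edge j i.
Proof. by rewrite /cox_edge eq_sym cox_sym. Qed.

Definition cox_path_alg := path_alg cox_edge.

(* C_{y_ij} for every edge y_ij with m finite; then m >= 3, as y_ij is an
   edge. *)
Inductive cox_rel : cox_path_alg -> Prop :=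
| CoxRel i j m (ij : cox_edge i j) of M i j = Some m :
    cox_rel (corner_eval i (cos_poly m)
      (pa_edge ij * pa_edge (cox_edgeC ij))).

Definition cox_ring := ring_quot cox_rel.

HB.instance Definition _ := GRing.PzRing.on cox_ring.

Definition cox_fin_pair := {p : 'I_N * 'I_N |
  (p.1 < p.2)%N && (if M p.1 p.2 is Some m then 3 <= m else false)%N}.
Definition cox_inf_pair := {p : 'I_N * 'I_N |
  (p.1 < p.2)%N && (M p.1 p.2 == None)}.

Definition cox_order (p : cox_fin_pair) : nat :=
  odflt 0%N (M (val p).1 (val p).2).

(* The two factors attached to a pair are indexed by the booleans. *)
Definition cox_index : choiceType :=
  ((cox_fin_pair * bool) + (cox_inf_pair * bool))%type.

Definition cox_factor (k : cox_index) : algType rat :=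
  match k with
  | inl (p, true) => laurent
  | inl (p, false) => {poly %/ ratp (cos_poly (cox_order p))}
  | inr _ => {poly rat}
  end.

Definition cox_coprod := coprod cox_factor.

HB.instance Definition _ := GRing.PzRing.on cox_coprod.
HB.instance Definition _ := GRing.Lmodule.on cox_coprod.

End CoxeterRing.

(* Main.v *)
Require Import Defs.
From HB Require Import structures.
From Stdlib Require Import Reals.
From mathcomp Require Import all_boot all_order all_algebra.
From mathcomp Require Import boolp Rstruct.
From mathcomp Require Import finmap.
From mathcomp Require Import -(notations) monalg.

Set Implicit Arguments.
Unset Strict Implicit.
Unset Printing Implicit Defensive.

Import Order.TTheory GRing.Theory Num.Theory.
Local Open Scope ring_scope.

(* R maps to the matrices over A by y_ij |-> x E_ij and y_ji |-> x^-1 t E_ji for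
   i < j and m_ij finite, and y_ij |-> x_1 E_ij, y_ji |-> x_2 E_ji if m_ij is
   infinite.  To see that this is injective, let V be the Q-vector space on the
   words in the undirected edges and, for an edge e, let s_e be the operator
   that prepends e to a word and rewrites e^(2d) by means of C_m(e^2) = 0, where
   d = deg C_m.  Since C_m(s_e^2) = 0 and C_m(0) <> 0, sending x and x_1, x_2 to
   s_e and t to s_e^2 makes V an A-module.  A path acts on the empty word as
   the class of its edge word, which is computed by the same rewriting as the
   normal form of the path in R; and the paths with a given terminus are
   determined by their edge words. *)

(** * Linear extensions and endomorphisms *)

Section MalgSum.
Variables (K : choiceType) (G S : zmodType) (f : K -> G -> S).
Hypothesis fB : forall x, zmod_morphism (f x).

(** Each [f x] is merely additive in the coefficient, so that integer combinations can also be sent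
    to matrices over a ring or to rational vectors. *)
Definition malg_sum (g : malg K G) : S := \sum_(x <- msupp g) f x (mcoeff x g).

Lemma malg_sum_term0 x : f x 0 = 0.
Proof. by rewrite -(subrr 0) fB subrr. Qed.

Lemma malg_sumEw (d : {fset K}) g : (msupp g `<=` d)%fset ->
  malg_sum g = \sum_(x <- d) f x (mcoeff x g).
Proof.
move=> le; rewrite /malg_sum (big_fset_incl _ le) //= => x _ /mcoeff_outdom ->.
exact: malg_sum_term0.
Qed.

Lemma malg_sumB : zmod_morphism malg_sum.
Proof.
move=> g h; rewrite (malg_sumEw (msuppB_le _ _)).
rewrite (malg_sumEw (fsubsetUl (msupp g) (msupp h))).
rewrite (malg_sumEw (fsubsetUr (msupp g) (msupp h))) -sumrB.
by apply: eq_bigr => x _; rewrite mcoeffB fB.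
Qed.

Lemma malg_sum0 : malg_sum 0 = 0.
Proof. by rewrite /malg_sum msupp0 big_seq_fset0. Qed.

Lemma malg_sumU x c : malg_sum (mkmalgU x c) = f x c.
Proof. by rewrite (malg_sumEw msuppU_le) big_seq_fset1 mcoeffUU. Qed.

End MalgSum.

Section LinearEndo.
Variables (R : comNzRingType) (V : lmodType R).

(** Linearity is stored as a boolean, so that two operators are equal as soon as they agree as
    functions. *)
Record lendo := Lendo { lendo_fun :> V -> V; _ : `[< linear lendo_fun >] }.

HB.instance Definition _ := [isSub for lendo_fun].
HB.instance Definition _ := [Choice of lendo by <:].

Definition mk_lendo (f : V -> V) (fL : linear f) : lendo := Lendo (asboolT fL).

Lemma lendoP (f : lendo) : linear f.
Proof. by case: f => f /= /asboolP. Qed.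

HB.instance Definition _ (f : lendo) :=
  GRing.isLinear.Build R V V _ f (lendoP f).

Lemma lendo_ext (f g : lendo) : f =1 g -> f = g.
Proof. by move=> fg; apply/val_inj/funext. Qed.

Fact lendo_zero_linear : linear (fun _ : V => 0 : V).
Proof. by move=> c u v; rewrite scaler0 addr0. Qed.
Fact lendo_opp_linear (f : lendo) : linear (fun v => - f v).
Proof. by move=> c u v; rewrite linearP opprD scalerN. Qed.
Fact lendo_add_linear (f g : lendo) : linear (fun v => f v + g v).
Proof. by move=> c u v; rewrite !linearP addrACA scalerDr. Qed.
Fact lendo_id_linear : linear (id : V -> V).
Proof. by []. Qed.
Fact lendo_comp_linear (f g : lendo) : linear (fun v => f (g v)).
Proof. by move=> c u v; rewrite !linearP. Qed.
Fact lendo_scale_linear a (f : lendo) : linear (fun v => a *: f v).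
Proof. by move=> c u v; rewrite linearP scalerDr !scalerA mulrC. Qed.

Definition lendo_zero := mk_lendo lendo_zero_linear.
Definition lendo_opp f := mk_lendo (lendo_opp_linear f).
Definition lendo_add f g := mk_lendo (lendo_add_linear f g).
Definition lendo_one := mk_lendo lendo_id_linear.
Definition lendo_mul f g := mk_lendo (lendo_comp_linear f g).
Definition lendo_scale a f := mk_lendo (lendo_scale_linear a f).

Fact lendo_addA : associative lendo_add.
Proof. by move=> f g h; apply: lendo_ext => v; apply: addrA. Qed.
Fact lendo_addC : commutative lendo_add.
Proof. by move=> f g; apply: lendo_ext => v; apply: addrC. Qed.
Fact lendo_add0 : left_id lendo_zero lendo_add.
Proof. by move=> f; apply: lendo_ext => v; apply: add0r. Qed.
Fact lendo_addN : left_inverse lendo_zero lendo_opp lendo_add.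
Proof. by move=> f; apply: lendo_ext => v; apply: addNr. Qed.

HB.instance Definition _ := GRing.isZmodule.Build lendo
  lendo_addA lendo_addC lendo_add0 lendo_addN.

Fact lendo_mulA : associative lendo_mul.
Proof. by move=> f g h; apply: lendo_ext. Qed.
Fact lendo_mul1l : left_id lendo_one lendo_mul.
Proof. by move=> f; apply: lendo_ext. Qed.
Fact lendo_mul1r : right_id lendo_one lendo_mul.
Proof. by move=> f; apply: lendo_ext. Qed.
Fact lendo_mulDl : left_distributive lendo_mul lendo_add.
Proof. by move=> f g h; apply: lendo_ext. Qed.
Fact lendo_mulDr : right_distributive lendo_mul lendo_add.
Proof. by move=> f g h; apply: lendo_ext => v; apply: raddfD. Qed.

HB.instance Definition _ := GRing.Zmodule_isPzRing.Build lendo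
  lendo_mulA lendo_mul1l lendo_mul1r lendo_mulDl lendo_mulDr.

Fact lendo_scaleA a b f :
  lendo_scale a (lendo_scale b f) = lendo_scale (a * b) f.
Proof. by apply: lendo_ext => v; apply: scalerA. Qed.
Fact lendo_scale1 : left_id 1 lendo_scale.
Proof. by move=> f; apply: lendo_ext => v; apply: scale1r. Qed.
Fact lendo_scaleDr : right_distributive lendo_scale +%R.
Proof. by move=> a f g; apply: lendo_ext => v; apply: scalerDr. Qed.
Fact lendo_scaleDl f : {morph lendo_scale^~ f : a b / a + b}.
Proof. by move=> a b; apply: lendo_ext => v; apply: scalerDl. Qed.

HB.instance Definition _ := GRing.Zmodule_isLmodule.Build R lendo
  lendo_scaleA lendo_scale1 lendo_scaleDr lendo_scaleDl.

Lemma lendoM (f g : lendo) v : (f * g) v = f (g v). Proof. by []. Qed.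
Lemma lendo1 v : (1 : lendo) v = v. Proof. by []. Qed.
Lemma lendoZ a (f : lendo) v : (a *: f) v = a *: f v. Proof. by []. Qed.
Lemma lendoD (f g : lendo) v : (f + g) v = f v + g v. Proof. by []. Qed.
Lemma lendo_sum I (r : seq I) (P : pred I) (F : I -> lendo) v :
  (\sum_(i <- r | P i) F i) v = \sum_(i <- r | P i) F i v.
Proof. exact: (big_morph (fun f : lendo => f v)). Qed.

Lemma lendo_scaleAl a (f g : lendo) : a *: (f * g) = (a *: f) * g.
Proof. by apply: lendo_ext. Qed.
Lemma lendo_scaleAr a (f g : lendo) : a *: (f * g) = f * (a *: g).
Proof. by apply: lendo_ext => v; rewrite lendoZ !lendoM lendoZ linearZ. Qed.

End LinearEndo.

(** * Operators on words *)

Section WordOperators.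
Variable T : choiceType.
Local Notation V := (free_alg rat T).

Definition wvec (w : seq T) : V := cata (w : words T).

Lemma wvec_neq0 w : wvec w != 0.
Proof. by rewrite /wvec /cata monalgU_eq0 oner_eq0. Qed.

Lemma lendo_wvec_ext (f g : lendo V) :
  (forall w, f (wvec w) = g (wvec w)) -> f = g.
Proof.
move=> fg; apply: lendo_ext => v; rewrite [v]cata_sum !raddf_sum /=.
by apply: eq_bigr => w _; rewrite !linearZ /= [f _]fg.
Qed.

Fact lendo_words_neq0 : (1 : lendo V) != 0.
Proof.
apply/eqP => /(congr1 (fun f : lendo V => f (wvec [::]))) /eqP.
by rewrite lendo1 (negPf (wvec_neq0 _)).
Qed.

(** The operators form a non-zero ring only if the space is non-zero; the algebra structure is
    therefore put on operators on words, where the empty word is a non-zero vector. *)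
Definition word_endo := lendo V.
HB.instance Definition _ := GRing.PzRing.on word_endo.
HB.instance Definition _ := GRing.Lmodule.on word_endo.
HB.instance Definition _ :=
  GRing.PzSemiRing_isNonZero.Build word_endo lendo_words_neq0.
HB.instance Definition _ :=
  GRing.Lmodule_isLalgebra.Build rat word_endo (@lendo_scaleAl rat V).
HB.instance Definition _ :=
  GRing.Lalgebra_isAlgebra.Build rat word_endo (@lendo_scaleAr rat V).

Definition word_lin_fun (h : seq T -> V) : V -> V :=
  malg_sum (fun (w : words T) (c : rat) => c *: h w).

Fact word_lin_linear (h : seq T -> V) : linear (word_lin_fun h).
Proof.
have hB (w : words T) : zmod_morphism (fun c : rat => c *: h w).
  by move=> a b; rewrite scalerBl.
pose F := GRing.isZmodMorphism.Build V V _ (malg_sumB hB).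
pose L : {additive V -> V} := HB.pack (word_lin_fun h) F.
have LZ c g : L (c *: g) = c *: L g.
  rewrite /= /word_lin_fun (malg_sumEw hB (msuppZ_le _ _)) scaler_sumr.
  by apply: eq_bigr => w _; rewrite mcoeffZ scalerA.
by move=> c u v; rewrite -[word_lin_fun h]/(L : V -> V) raddfD LZ.
Qed.

Definition word_lin h : word_endo := mk_lendo (word_lin_linear h).

Lemma word_linE h w : word_lin h (wvec w) = h w.
Proof.
have hB (x : words T) : zmod_morphism (fun c : rat => c *: h x).
  by move=> a b; rewrite scalerBl.
by rewrite /= /word_lin_fun /wvec /cata (malg_sumU hB) scale1r.
Qed.

Variables (e : T) (P : {poly int}).
Local Notation d := (size P).-1.

Definition lead_run (w : seq T) := find (predC1 e) w.

(** True when one more letter [e] completes a block of 2d. For d = 0, in particular for [P = 0],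
    this never holds and [run_op] only prepends. *)
Definition run_full w := ((lead_run w %% d.*2).+1 == d.*2)%N.

(** The letter being prepended is the first of the block e^(2d); [w] supplies the other 2d - 1,
    which are dropped. *)
Definition run_red w : V :=
  - \sum_(m < d) (P`_m)%:~R *: wvec (nseq m.*2 e ++ drop (d.*2).-1 w).

(* The length of the leading run is taken modulo 2d so that the rewriting rule
   e^(2d) = - \sum_(m < d) P_m e^(2m) defines an operator on all the words,
   not just on the reduced ones. *)
Definition run_op : word_endo :=
  word_lin (fun w => if run_full w then run_red w else wvec (e :: w)).

Lemma run_opE w :
  run_op (wvec w) = if run_full w then run_red w else wvec (e :: w).
Proof. exact: word_linE. Qed.

Lemma lead_run_nseq k w : lead_run (nseq k e ++ w) = (k + lead_run w)%N.
Proof.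
by elim: k => //= k IH; rewrite /lead_run /= eqxx /= -/(lead_run _) IH.
Qed.

Lemma lead_run_split w k : (k <= lead_run w)%N -> w = nseq k e ++ drop k w.
Proof.
elim: k w => [|k IH] [|x w] //=.
by rewrite /lead_run /=; case: eqP => //= -> /IH {1}->.
Qed.

(** The run starts at a multiple of 2d, so fewer than 2d prependings never complete a block. *)
Lemma run_op_exp w k : (d.*2 %| lead_run w)%N -> (k < d.*2)%N ->
  (run_op ^+ k) (wvec w) = wvec (nseq k e ++ w).
Proof.
move=> dv; elim: k => [|k IH] lt; first by rewrite expr0.
rewrite exprS [LHS]lendoM IH ?(ltnW lt) // run_opE /run_full lead_run_nseq.
rewrite -modnDmr (eqP dv) addn0 modn_small ?(ltnW lt) //.
by rewrite (ltn_eqF lt).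
Qed.

(** Only the last of the 2d applications rewrites, and by [run_op_exp] each word of the result comes
    from [w] by a smaller power of the operator. *)
Lemma run_op_full w : (d.*2 %| lead_run w)%N -> (0 < d)%N ->
  (run_op ^+ d.*2) (wvec w) =
  - \sum_(m < d) (P`_m)%:~R *: (run_op ^+ m.*2) (wvec w).
Proof.
move=> dv d0; have dd : (0 < d.*2)%N by rewrite double_gt0.
rewrite -{1}(prednK dd) exprS [LHS]lendoM run_op_exp ?prednK //.
rewrite run_opE /run_full lead_run_nseq -modnDmr (eqP dv) addn0.
rewrite modn_small ?prednK // eqxx /run_red.
have -> : drop (d.*2).-1 (nseq (d.*2).-1 e ++ w) = w.
  by rewrite drop_size_cat ?size_nseq.
apply: (congr1 -%R); apply: eq_bigr => m _.
by rewrite run_op_exp // ltn_double.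
Qed.

Lemma horner_algE (A : algType rat) (a : A) (p : {poly rat}) :
  horner_alg a p = \sum_(i < size p) p`_i *: a ^+ i.
Proof.
rewrite /horner_alg /horner_morph horner_coef size_map_poly.
by apply: eq_bigr => i _; rewrite coef_map mulr_algl.
Qed.

(** On a word whose leading run is a multiple of 2d this is [run_op_full]. Any other word is reached
    from such a word by a power of [run_op], which commutes with the value of the polynomial. *)
Lemma run_op_root : P \is monic -> (0 < d)%N ->
  horner_alg (run_op ^+ 2) (ratp P) = 0.
Proof.
move=> Pmon d0; set H := horner_alg _ _.
have szP : size (ratp P) = d.+1.
  rewrite size_map_inj_poly ?rmorph0 //; last exact: intr_inj.
  by rewrite prednK // size_poly_gt0 monic_neq0.
have HE : H = \sum_(i < d) (P`_i)%:~R *: run_op ^+ i.*2 + run_op ^+ d.*2.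
  rewrite /H horner_algE szP big_ord_recr /=.
  have -> : (ratp P)`_d = 1.
    by rewrite coef_map -[P`_d]/(lead_coef P) (eqP Pmon).
  rewrite scale1r -exprM mul2n; congr (_ + _); apply: eq_bigr => i _.
  by rewrite coef_map -exprM mul2n.
have Hcomm k : GRing.comm H (run_op ^+ k).
  apply: commr_sym; rewrite HE; apply: commrD; last first.
    by apply/commrX/commr_sym/commrX.
  apply: commr_sum => i _; rewrite /GRing.comm -scalerAl -scalerAr.
  by rewrite -!exprD addnC.
(* Cutting k letters off the run of [w] leaves a run divisible by 2d, and [run_op ^+ k] puts them
   back. *)
apply: lendo_wvec_ext => w; pose k := (lead_run w %% d.*2)%N.
have klt : (k < d.*2)%N by rewrite ltn_mod double_gt0.
have wE := lead_run_split (leq_mod (lead_run w) d.*2).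
have dv : (d.*2 %| lead_run (drop k w))%N.
  have := congr1 lead_run wE; rewrite lead_run_nseq -/k => E.
  move: E; rewrite {1}(divn_eq (lead_run w) d.*2) addnC => /addnI <-.
  exact: dvdn_mull.
rewrite wE -run_op_exp // -[LHS]lendoM Hcomm [LHS]lendoM HE lendoD lendo_sum.
by rewrite run_op_full // subrr linear0.
Qed.

End WordOperators.

(** * Morphisms from the factors of the coproduct *)

Section MalgSumMul.
Variables (R : comNzRingType) (K : finObjCatType) (S : pzRingType).
Variable f : K -> R -> S.
Hypothesis fB : forall x, zmod_morphism (f x).
Hypothesis fM : forall x y a b,
  f x a * f y b = if cod x == dom y then f (cmp x y) (a * b) else 0.

Lemma malg_sumM : {morph (malg_sum f : catalg R K -> S) : g h / g * h}.
Proof.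
move=> g h; pose F := GRing.isZmodMorphism.Build _ _ _ (malg_sumB fB).
pose L : {additive malg K R -> S} := HB.pack (malg_sum f) F.
have LE u : malg_sum f u = L u by [].
rewrite [LHS]LE [g * h]/(cat_mul g h) /cat_mul raddf_sum /malg_sum mulr_suml.
apply: eq_bigr => x _; rewrite raddf_sum mulr_sumr.
apply: eq_bigr => y _; rewrite fM /cat_term.
by case: ifP => _; rewrite ?raddf0 // -LE malg_sumU.
Qed.

End MalgSumMul.

Lemma lrmorphism_intro (R : pzRingType) (A B : algType R) (f : A -> B) :
  zmod_morphism f -> monoid_morphism f -> scalable f ->
  exists phi : {lrmorphism A -> B}, phi =1 f.
Proof.
move=> fB fM fZ.
pose fB' := GRing.isZmodMorphism.Build A B f fB.
pose fM' := GRing.isMonoidMorphism.Build A B f fM.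
pose fZ' := GRing.isScalable.Build R A B *:%R f fZ.
pose phi : {lrmorphism A -> B} := HB.pack f fB' fM' fZ'.
by exists phi.
Qed.

Lemma poly_lift (C : algType rat) (a : C) :
  exists phi : {lrmorphism {poly rat} -> C}, forall p, phi p = horner_alg a p.
Proof.
apply: lrmorphism_intro; first exact: rmorphB.
  by split; [apply: rmorph1 | apply: rmorphM].
by move=> c x; rewrite -mul_polyC rmorphM /= horner_algC mulr_algl.
Qed.

Section LaurentLift.
Variables (C : algType rat) (u v : C).
Hypotheses (uv : u * v = 1) (vu : v * u = 1).

(** The integer powers of [u], with [v] as its inverse; [Negz k] is -(k + 1), whence the exponent
    [k.+1]. *)
Definition unit_expz (n : int) : C :=
  match n with Posz k => u ^+ k | Negz k => v ^+ k.+1 end.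

Lemma unit_expzS n : unit_expz (1 + n) = u * unit_expz n.
Proof.
case: n => [k|[|k]].
- by rewrite -[1 + _]/(Posz k.+1) /= exprS.
- by rewrite /= expr1 uv.
have -> : 1 + Negz k.+1 = Negz k.
  by rewrite !NegzE [in LHS]intS opprD addrA subrr add0r.
by rewrite /= (exprS _ k.+1) mulrA uv mul1r.
Qed.

Lemma unit_expzP n : unit_expz (- 1 + n) = v * unit_expz n.
Proof.
have {2}-> : n = 1 + (- 1 + n) by rewrite addNKr.
by rewrite unit_expzS mulrA vu mul1r.
Qed.

Lemma unit_expzD m n : unit_expz (m + n) = unit_expz m * unit_expz n.
Proof.
elim/int_ind: m => [|k IH|k IH].
- by rewrite add0r mul1r.
- by rewrite intS -addrA !unit_expzS IH mulrA.
by rewrite intS opprD -addrA !unit_expzP IH mulrA.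
Qed.

Lemma laurent_lift : exists phi : {lrmorphism laurent -> C},
  phi (cata (1 : zexp)) = u /\ phi (cata (- 1 : zexp)) = v.
Proof.
pose h (n : zexp) (c : rat) := c *: unit_expz n.
have hB n : zmod_morphism (h n) by move=> a b; apply: scalerBl.
have hM m n a b : h m a * h n b =
    if cod m == dom n then h (cmp m n) (a * b) else 0.
  rewrite eqxx /h -scalerAl -scalerAr scalerA.
  by rewrite -unit_expzD.
pose f : laurent -> C := malg_sum h.
have fM : monoid_morphism f.
  split; last exact: malg_sumM.
  rewrite cata1 (bigD1 tt) //= big1 ?addr0 => [|[]//].
  by rewrite /f /cata malg_sumU // /h scale1r.
have fZ : scalable f.
  move=> c g; rewrite /f (malg_sumEw hB (msuppZ_le _ _)) scaler_sumr.
  by apply: eq_bigr => w _; rewrite mcoeffZ /h scalerA.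
have [phi E] := lrmorphism_intro (malg_sumB hB : zmod_morphism f) fM fZ.
exists phi; rewrite !E /f /cata !malg_sumU // /h !scale1r.
by split; rewrite /= expr1.
Qed.

End LaurentLift.

(** An element of the quotient is a remainder modulo [p]. Evaluation at [a] is multiplicative on
    remainders because reduction modulo [p] does not change the value at a root of [p]. *)
Lemma qpoly_lift (C : algType rat) (a : C) (p : {poly rat}) :
  mk_monic p = p -> horner_alg a p = 0 ->
  exists phi : {lrmorphism {poly %/ p} -> C}, phi 'qX = a.
Proof.
move=> pE pa; have pM : p \is monic by rewrite -pE monic_mk_monic.
have modE q : horner_alg a (q %% p) = horner_alg a q.
  by rewrite [q in RHS](divp_eq q p) rmorphD rmorphM /= pa mulr0 add0r.
have rmodE q :
    horner_alg a (Pdiv.CommonRing.rmodp q (mk_monic p)) = horner_alg a q.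
  by rewrite pE -Pdiv.IdomainMonic.modpE // modE.
pose f (q : {poly %/ p}) : C := horner_alg a (q : {poly rat}).
have fB : zmod_morphism f by move=> x y; rewrite /f raddfB.
have fM : monoid_morphism f.
  by split=> [|x y]; rewrite /f ?rmorph1 // rmodE rmorphM.
have fZ : scalable f 
  by move=> c x; rewrite /f /= -mul_polyC rmorphM /= horner_algC mulr_algl.
have [phi E] := lrmorphism_intro fB fM fZ.
by exists phi; rewrite E /f rmodE; apply: horner_algX.
Qed.

(** * Evaluation of integer polynomials in a ring *)

Section IntEval.
Implicit Types (p : {poly int}).

(** Only integer multiples occur, so the same expression makes sense in R and in A and is preserved
    by ring morphisms. *)
Definition int_eval (A : pzRingType) p (a : A) : A :=
  \sum_(k < size p) a ^+ k *~ p`_k.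

Lemma int_eval_morph (A B : pzRingType) (f : {rmorphism A -> B}) p a :
  int_eval p (f a) = f (int_eval p a).
Proof.
rewrite /int_eval [RHS]raddf_sum; apply: eq_bigr => k _.
by rewrite -rmorphXn [RHS]raddfMz.
Qed.

(** Serves for x^-1 t x, the product of the two generators of an edge of finite label when it starts
    from the larger vertex. *)
Lemma int_eval_conj (A : pzRingType) p (a u v : A) :
  u * v = 1 -> v * u = 1 -> int_eval p (v * a * u) = v * int_eval p a * u.
Proof.
move=> uv vu; rewrite /int_eval mulr_sumr mulr_suml; apply: eq_bigr => k _.
rewrite mulrzAr mulrzAl; congr (_ *~ _).
elim: (k : nat) => [|n IH]; first by rewrite !expr0 mulr1.
by rewrite !exprS IH !mulrA -[v * a * u * v]mulrA uv mulr1.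
Qed.

Lemma int_eval_qpolyX p : mk_monic (ratp p) = ratp p ->
  int_eval p ('qX : {poly %/ ratp p}) = 0.
Proof.
move=> pE; rewrite /qpolyX int_eval_morph; apply: val_inj.
have -> : int_eval p 'X = ratp p.
  rewrite -[ratp p]coefK poly_def size_map_inj_poly ?rmorph0 //; last first.
    exact: intr_inj.
  by apply: eq_bigr => k _; rewrite coef_map /= -scaler_int.
by rewrite /= pE Pdiv.RingMonic.rmodpp // -pE monic_mk_monic.
Qed.

End IntEval.

(** * The polynomials C_m *)

(** For m > 2 the angle pi/m lies strictly between 0 and pi/2, where the cosine is positive. *)
Lemma four_cos2_neq0 m : (2 < m)%N -> four_cos2 m != 0.
Proof.
move=> m2; rewrite /four_cos2 mulf_neq0 ?pnatr_eq0 //.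
rewrite expf_neq0 //.
have pi0 : 0 < PI :> R by apply/RltP/PI_RGT_0.
have mR : (0 : R) < m%:R by rewrite ltr0n (leq_trans _ m2).
have half : Rdiv PI (IZR 2) = PI / 2%:R.
  by rewrite RdivE (IZRposE 2) INRE.
apply: lt0r_neq0; apply/RltP/cos_gt_0; apply/RltP; rewrite half.
  by rewrite RoppE (@lt_trans _ _ 0) ?oppr_lt0 ?divr_gt0.
by rewrite ltr_pM2l // ltf_pV2 ?posrE // ltr_nat.
Qed.

Lemma cos_poly_size m : (0 < m)%N -> (1 < size (cos_poly m))%N.
Proof.
move=> m0; have := size_mk_monic_gt1 (ratp (cos_poly m)).
rewrite mk_monic_cos_poly // size_map_inj_poly ?rmorph0 //; exact: intr_inj.
Qed.

Lemma cos_poly_monic m : (0 < m)%N -> cos_poly m \is monic.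
Proof.
move=> /cos_polyP[]; rewrite monicE lead_coef_map_inj ?rmorph0 //; last first.
  exact: intr_inj.
by rewrite -[1]/(1%:~R) eqr_int => ? _ _; rewrite monicE.
Qed.

(** Otherwise X divides C_m, and the quotient, of smaller degree, still vanishes at the non-zero
    number 4 cos^2(pi/m), against minimality. *)
Lemma cos_poly_coef0 m : (2 < m)%N -> (cos_poly m)`_0 != 0.
Proof.
move=> m2; have m0 : (0 < m)%N by apply: leq_trans m2.
have [mon rt dvd] := cos_polyP m0; apply/eqP => c0.
have /factor_theorem [q qE] : root (ratp (cos_poly m)) 0.
  by rewrite /root horner_coef0 coef_map c0.
rewrite subr0 in qE.
have q0 : q != 0.
  by apply: contraNneq (monic_neq0 mon) => q0; rewrite qE q0 mul0r.
have : ratp (cos_poly m) %| q.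
  apply: dvd; move: rt; rewrite qE rmorphM /= map_polyX rootM rootX.
  by rewrite (negPf (four_cos2_neq0 m2)) orbF.
by move/(dvdp_leq q0); rewrite qE size_mulX // ltnn.
Qed.

(** Write p = q X + p_0; then p(a) = 0 gives q(a) a = a q(a) = - p_0, so the inverse is - q(a) /
    p_0. *)
Lemma horner_alg_unit (C : algType rat) (a : C) (p : {poly rat}) :
  p`_0 != 0 -> horner_alg a p = 0 ->
  exists2 b, a * b = 1 & b * a = 1.
Proof.
move=> p0 pa.
have /factor_theorem [q qE] : root (p - (p`_0)%:P) 0.
  by rewrite /root hornerD hornerN hornerC horner_coef0 subrr.
have qa : horner_alg a q * a = - (p`_0)%:A.
  have := congr1 (horner_alg a) qE.
  by rewrite subr0 rmorphB rmorphM /= pa horner_algC horner_algX sub0r.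
have aq : a * horner_alg a q = - (p`_0)%:A.
  have -> : a * horner_alg a q = horner_alg a ('X * q).
    by rewrite rmorphM /= horner_algX.
  by rewrite mulrC rmorphM /= horner_algX.
exists (- (p`_0)^-1 *: horner_alg a q).
  by rewrite -scalerAr aq scalerN scaleNr opprK scalerA mulVf // scale1r.
by rewrite -scalerAl qa scalerN scaleNr opprK scalerA mulVf // scale1r.
Qed.

(** * The action of the coproduct on words *)

Section EdgeOperators.
Variables (N : nat) (M : coxeter_matrix N).
Implicit Types (i j l : 'I_N) (s t : seq 'I_N).
Local Notation A := (cox_coprod M).
Local Notation edge := (cox_edge M).

(** An undirected edge is represented by its increasing pair, which is also the index of its factors
    in the coproduct. *)
Definition uedge i j : 'I_N * 'I_N := if (i < j)%N then (i, j) else (j, i).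

Lemma uedgeC i j : uedge i j = uedge j i.
Proof. by rewrite /uedge; case: ltngtP => // /val_inj ->. Qed.

(** An undirected edge and one of its endpoints determine the other endpoint. *)
Lemma uedge_injl j : injective (uedge^~ j).
Proof.
move=> i k; rewrite /uedge; case: ifP => ij; case: ifP => kj [] //.
  by move=> E; rewrite E ltnn in ij.
by move=> E; rewrite -E ltnn in kj.
Qed.

(** The value 0 at an infinite label gives d = 0 in [run_op], so that no word is ever rewritten. *)
Definition edge_poly (e : 'I_N * 'I_N) : {poly int} :=
  if M e.1 e.2 is Some m then cos_poly m else 0.

Lemma edge_poly_uedge i j :
  edge_poly (uedge i j) = if M i j is Some m then cos_poly m else 0.
Proof. by rewrite /edge_poly /uedge; case: ifP => //= _; rewrite cox_sym. Qed.

Local Notation T := ('I_N * 'I_N)%type.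

Definition edge_op (e : T) : word_endo T := run_op e (edge_poly e).

Lemma fin_pairE (p : cox_fin_pair M) :
  M (val p).1 (val p).2 = Some (cox_order p) /\ (2 < cox_order p)%N.
Proof.
have /andP[_] := valP p; rewrite /cox_order.
by case: (M _ _) => [m|].
Qed.

Lemma edge_op_root (p : cox_fin_pair M) :
  horner_alg (edge_op (val p) ^+ 2) (ratp (cos_poly (cox_order p))) = 0.
Proof.
have [E m3] := fin_pairE p.
have m0 : (0 < cox_order p)%N by apply: leq_trans m3.
have PE : edge_poly (val p) = cos_poly (cox_order p) by rewrite /edge_poly E.
rewrite -PE; apply: run_op_root; rewrite PE; first exact: cos_poly_monic.
by rewrite -subn1 subn_gt0 cos_poly_size.
Qed.

(** The square of the operator is a root of C_m, whose constant term is non-zero; hence the square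
    is invertible, and so is the operator. *)
Lemma edge_op_unit (p : cox_fin_pair M) :
  exists2 v, edge_op (val p) * v = 1 & v * edge_op (val p) = 1.
Proof.
have C0 : (ratp (cos_poly (cox_order p)))`_0 != 0.
  rewrite coef_map /= intr_eq0; apply: cos_poly_coef0.
  by have [] := fin_pairE p.
have [b ab ba] := horner_alg_unit C0 (edge_op_root p).
set a := edge_op _ in ab ba *.
have ab1 : a * (a * b) = 1 by rewrite mulrA -expr2.
have ba1 : (b * a) * a = 1 by rewrite -mulrA -expr2.
(* A left inverse and a right inverse of [a] coincide. *)
have E : b * a = a * b by rewrite -[LHS]mulr1 -ab1 [LHS]mulrA ba1 mul1r.
by exists (a * b) => //; rewrite -E.
Qed.

Local Notation factor_in k := (@coprod_in _ _ (@cox_factor N M) k).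

Definition fin_x (n : int) (p : cox_fin_pair M) : A :=
  factor_in (inl (p, true)) (cata (n : zexp) : laurent).
Definition fin_t (p : cox_fin_pair M) : A :=
  factor_in (inl (p, false)) 'qX.
Definition inf_x b (p : cox_inf_pair M) : A :=
  factor_in (inr (p, b)) 'X.

(** The four [insub] tests exclude one another: they distinguish the order of i and j and whether
    the label is finite. The final 0 is for pairs that are not edges. *)
Definition edge_gen i j : A :=
  if insub (i, j) is Some p then fin_x 1 p else
  if insub (j, i) is Some p then fin_x (- 1) p * fin_t p else
  if insub (i, j) is Some p then inf_x true p else
  if insub (j, i) is Some p then inf_x false p else 0.

Lemma edge_gen_fin i j m : (i < j)%N -> M i j = Some m -> (2 < m)%N ->
  exists p : cox_fin_pair M, [/\ val p = (i, j),
    edge_gen i j = fin_x 1 p & edge_gen j i = fin_x (- 1) p * fin_t p].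
Proof.
move=> ij Mij m3; rewrite /edge_gen.
case: (insubP (cox_fin_pair M) (i, j)) => [p _ vp|]; last first.
  by rewrite /= ij Mij m3.
case: (insubP (cox_fin_pair M) (j, i)) => [q /= /andP[ji]|_].
  by rewrite ltnNge ltnW in ji.
by exists p.
Qed.

Lemma edge_gen_inf i j : (i < j)%N -> M i j = None ->
  exists p : cox_inf_pair M, [/\ val p = (i, j),
    edge_gen i j = inf_x true p & edge_gen j i = inf_x false p].
Proof.
move=> ij Mij; have Mji : M j i = None by rewrite cox_sym.
rewrite /edge_gen.
case: (insubP (cox_fin_pair M) (i, j)) => [p /=|_].
  by rewrite Mij andbF.
case: (insubP (cox_fin_pair M) (j, i)) => [p /=|_].
  by rewrite Mji andbF.
case: (insubP (cox_inf_pair M) (i, j)) => [p _ vp|]; last first.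
  by rewrite /= ij Mij.
case: (insubP (cox_inf_pair M) (j, i)) => [q /= /andP[ji]|_].
  by rewrite ltnNge ltnW in ji.
by exists p.
Qed.

(** Both orientations of an edge act by the same operator s: for a finite label, x acts as s and
    x^-1 t as s^-1 s^2 = s. *)
Lemma edge_op_rep : exists G : {rmorphism A -> word_endo T},
  forall i j, edge i j -> G (edge_gen i j) = edge_op (uedge i j).
Proof.
(* The type of the morphism depends on the factor, so its prescribed values are given by cases. For
   x^-1 it suffices to record that its image is a left inverse of s. *)
pose spec (k : cox_index M) :
    {lrmorphism cox_factor k -> word_endo T} -> Prop :=
  match k with
  | inl (p, true) => fun phi : {lrmorphism laurent -> word_endo T} =>
      phi (cata (1 : zexp)) = edge_op (val p) /\
      phi (cata (- 1 : zexp)) * edge_op (val p) = 1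
  | inl (p, false) => fun phi : {lrmorphism {poly %/ _} -> _} =>
      phi 'qX = edge_op (val p) ^+ 2
  | inr (p, b) => fun phi : {lrmorphism {poly rat} -> _} =>
      phi 'X = edge_op (val p)
  end.
have specP (k : cox_index M) : exists phi, spec k phi.
  case: k => [[p []]|[p b]] /=.
  - have [v uv vu] := edge_op_unit p.
    have [phi [E1 E2]] := laurent_lift uv vu.
    exists phi; split; first exact: E1.
    exact: etrans (congr1 (fun z => z * _) E2) vu.
  - apply: qpoly_lift (edge_op_root p); apply: mk_monic_cos_poly.
    by have [_ m3] := fin_pairE p; apply: leq_trans m3.
  have [phi E] := poly_lift (edge_op (val p)).
  by exists phi; rewrite E; apply: horner_algX.
pose phi k := projT1 (cid (specP k)).
have phiP k : spec k (phi k) := projT2 (cid (specP k)).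
have [G [_ GE]] := coprod_lift phi.
have Gx p : G (fin_x 1 p) = edge_op (val p).
  by rewrite [LHS]GE; have [] := phiP (inl (p, true)).
have Gx' p : G (fin_x (- 1) p) * edge_op (val p) = 1.
  by rewrite [X in X * _]GE; have [] := phiP (inl (p, true)).
have Gt p : G (fin_t p) = edge_op (val p) ^+ 2.
  by rewrite [LHS]GE; apply: (phiP (inl (p, false))).
have Gxt p : G (fin_x (- 1) p * fin_t p) = edge_op (val p).
  have mulE (a b c : word_endo T) : a * c = 1 -> b = c ^+ 2 -> a * b = c.
    by move=> ac ->; rewrite expr2 mulrA ac mul1r.
  exact: etrans (rmorphM G _ _) (mulE _ _ _ (Gx' p) (Gt p)).
have Gy b p : G (inf_x b p) = edge_op (val p).
  by rewrite [LHS]GE; apply: (phiP (inr (p, b))).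
exists G; suff main i j : edge i j -> (i < j)%N ->
    G (edge_gen i j) = edge_op (uedge i j) /\
    G (edge_gen j i) = edge_op (uedge i j).
  move=> i j ij; have /andP[] := ij; rewrite neq_ltn => /orP[lt|lt] _.
    by have [] := main _ _ ij lt.
  by rewrite uedgeC; have [] := main _ _ (cox_edgeC ij) lt.
move=> ij lt; have /andP[_] := ij; rewrite /uedge lt.
case E : (M i j) => [m|] => [m3|_].
  by have [p [<- -> ->]] := edge_gen_fin lt E m3.
by have [p [<- -> ->]] := edge_gen_inf lt E.
Qed.

Lemma fin_xD m n p : fin_x m p * fin_x n p = fin_x (m + n) p.
Proof.
apply: etrans (esym (rmorphM (factor_in (inl (p, true))) _ _)) _.
by congr coprod_in; apply: etrans (cataM _ _ _) _.
Qed.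

Lemma fin_x0 p : fin_x 0 p = 1.
Proof.
apply: etrans (rmorph1 (factor_in (inl (p, true)))).
by congr coprod_in; rewrite [RHS]cata1 (bigD1 tt) //= big1 ?addr0 // => -[].
Qed.

(** The product is t if i < j, and its conjugate x^-1 t x if j < i. *)
Lemma edge_gen_root i j m : edge i j -> M i j = Some m ->
  int_eval (cos_poly m) (edge_gen i j * edge_gen j i) = 0.
Proof.
move=> /andP[+ +] E; rewrite E neq_ltn => ij m3.
have t0 p : int_eval (cos_poly (cox_order p)) (fin_t p) = 0.
  apply: etrans (int_eval_morph (factor_in (inl (p, false))) _ _) _.
  rewrite -[RHS](raddf0 (factor_in (inl (p, false)))).
  congr coprod_in; apply: int_eval_qpolyX; apply: mk_monic_cos_poly.
  by have [_] := fin_pairE p; apply: leq_trans.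
have xV p : fin_x 1 p * fin_x (- 1) p = 1 by rewrite fin_xD fin_x0.
have Vx p : fin_x (- 1) p * fin_x 1 p = 1 by rewrite fin_xD fin_x0.
have order (p : cox_fin_pair M) i' j' :
    val p = (i', j') -> M i' j' = Some m -> cox_order p = m.
  by move=> vp; have [] := fin_pairE p; rewrite vp /= => -> _ [].
case/orP: ij => lt.
  have [p [vp -> ->]] := edge_gen_fin lt E m3.
  by rewrite mulrA xV mul1r -(order p _ _ vp E) t0.
rewrite cox_sym in E; have [p [vp -> ->]] := edge_gen_fin lt E m3.
by rewrite int_eval_conj // -(order p _ _ vp E) t0 mulr0 mul0r.
Qed.

End EdgeOperators.

(** * The matrix representation *)

Section ElementaryMatrix.
Variables (A : pzRingType) (n : nat).
Implicit Types (i j k l : 'I_n) (a b : A).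

Definition entry_mx i j a : 'M[A]_n :=
  \matrix_(k, l) if (k == i) && (l == j) then a else 0.

Lemma entry_mxB i j : zmod_morphism (entry_mx i j).
Proof.
by move=> a b; apply/matrixP => k l; rewrite !mxE; case: ifP; rewrite ?subr0.
Qed.

HB.instance Definition _ i j := GRing.isZmodMorphism.Build A 'M[A]_n
  (entry_mx i j) (entry_mxB i j).

Lemma entry_mxM i j k l a b :
  entry_mx i j a *m entry_mx k l b = if j == k then entry_mx i l (a * b) else 0.
Proof.
apply/matrixP => p q; rewrite mxE (bigD1 j) //= big1 => [|r rj]; last first.
  by rewrite !mxE (negPf rj) andbF mul0r.
rewrite addr0 !mxE eqxx andbT; case: (j == k) => /=; rewrite !mxE.
  by case: (p == i); case: (q == l); rewrite ?mul0r ?mulr0.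
by rewrite mulr0.
Qed.

End ElementaryMatrix.

Lemma ring_quot_lift (P : pzRingType) (G : P -> Prop) (S : pzRingType)
    (F : P -> S) :
  zmod_morphism F -> {morph F : x y / x * y} -> (forall x, G x -> F x = 0) ->
  exists f : ring_quot G -> S,
    [/\ zmod_morphism f, {morph f : x y / x * y} &
        forall x, f (rq_pi G x) = F x].
Proof.
move=> FB FM F_G.
have F_0 : F 0 = 0 by rewrite -(subrr 0) FB subrr.
have FI x : gen_ideal G x -> F x = 0.
  elim=> {x}[x /F_G| |x y _ Fx _ Fy|a x _ Fx|a x _ Fx] //.
  - by rewrite FB Fx Fy subrr.
  - by rewrite FM Fx mulr0.
  - by rewrite FM Fx mul0r.
pose f (q : ring_quot G) : S := F (repr q).
have f_pi x : f (rq_pi G x) = F x.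
  apply/eqP; rewrite -subr_eq0 -FB; apply/eqP/FI/rq_piP.
  by rewrite rq_reprK.
exists f; split=> // p q; have [[x ->] [y ->]] := (rq_surj p, rq_surj q).
  by rewrite -raddfB !f_pi FB.
by rewrite -rmorphM !f_pi FM.
Qed.

Section PathRep.
Variables (N : nat) (M : coxeter_matrix N) (A : pzRingType).
Variable gen : 'I_N -> 'I_N -> A.
Hypothesis gen_root : forall i j m, cox_edge M i j -> M i j = Some m ->
  int_eval (cos_poly m) (gen i j * gen j i) = 0.
Implicit Types (i j l : 'I_N) (s t : seq 'I_N).
Local Notation edge := (cox_edge M).
Local Notation P := (path_alg edge).

Fixpoint path_gen i s : A :=
  if s is j :: t then gen i j * path_gen j t else 1.

Lemma path_gen_cat i s t :
  path_gen i (s ++ t) = path_gen i s * path_gen (last i s) t.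
Proof.
by elim: s i => [|j s IH] i /=; rewrite ?mul1r // IH mulrA.
Qed.

(** The last index is never attained: the last row and column of every image are zero, including
    those of the image of 1. *)
Definition mx_idx (i : 'I_N) : 'I_N.+1 := widen_ord (leqnSn N) i.

Lemma mx_idx_eq i j : (mx_idx i == mx_idx j) = (i == j).
Proof. by []. Qed.

Definition path_mx (p : dpath edge) (c : int) : 'M[A]_N.+1 :=
  entry_mx (mx_idx (porigin p)) (mx_idx (pterminus p))
    (path_gen (val p).1 (val p).2 *~ c).

Lemma path_mxB p : zmod_morphism (path_mx p).
Proof. by move=> a b; rewrite /path_mx mulrzBr raddfB. Qed.

Lemma path_mxM (p q : dpath edge) a b :
  path_mx p a * path_mx q b =
  if cod p == dom q then path_mx (cmp p q) (a * b) else 0.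
Proof.
rewrite [LHS]entry_mxM mx_idx_eq; case: eqP => // pq.
rewrite /path_mx porigin_concat // pterminus_concat //; congr entry_mx.
rewrite [val (cmp p q)](val_pconcat pq) /= path_gen_cat mulrzAl mulrzAr.
by rewrite -mulrzA [a * b]mulrC -[last _ _]/(pterminus p) pq.
Qed.

Definition path_rep : P -> 'M[A]_N.+1 := malg_sum path_mx.

Lemma path_repB : zmod_morphism path_rep.
Proof. exact: malg_sumB path_mxB. Qed.

Lemma path_repM : {morph path_rep : x y / x * y}.
Proof. exact: malg_sumM path_mxB path_mxM. Qed.

HB.instance Definition _ :=
  GRing.isZmodMorphism.Build P 'M[A]_N.+1 path_rep path_repB.

Lemma path_rep_cata p : path_rep (cata p) = path_mx p 1.
Proof. exact: malg_sumU path_mxB _ _. Qed.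

Lemma path_rep_edge i j (ij : edge i j) :
  path_rep (pa_edge ij) = entry_mx (mx_idx i) (mx_idx j) (gen i j).
Proof.
by rewrite [LHS]path_rep_cata /path_mx /= mulr1.
Qed.

Lemma path_rep_vertex i :
  path_rep (pa_vertex edge i) = entry_mx (mx_idx i) (mx_idx i) 1.
Proof. by rewrite [LHS]path_rep_cata. Qed.

(** The matrices supported at the entry (i, i) form a copy of A whose identity is the image of [i];
    the factor [i] in [corner_eval] puts the constant term there too. *)
Lemma path_rep_corner_eval w i p (z : P) :
  path_rep z = entry_mx (mx_idx i) (mx_idx i) w ->
  path_rep (corner_eval i p z) = entry_mx (mx_idx i) (mx_idx i) (int_eval p w).
Proof.
move=> zE.
have ezE k : path_rep (pa_vertex edge i * z ^+ k) =
    entry_mx (mx_idx i) (mx_idx i) (w ^+ k).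
  elim: k => [|k IH]; first by rewrite expr0 mulr1 path_rep_vertex.
  rewrite exprSr mulrA; apply: etrans (path_repM _ _) _; rewrite IH zE.
  by apply: etrans (entry_mxM _ _ _ _ _ _) _; rewrite eqxx exprSr.
rewrite /corner_eval /int_eval [LHS]raddf_sum [RHS]raddf_sum.
(* Scaling by an integer is turned into an integer multiple, which every additive map preserves. *)
apply: eq_bigr => k _; rewrite -[p`_k in LHS]intz scaler_int.
by rewrite [RHS]raddfMz [LHS]raddfMz; congr (_ *~ _); apply: ezE.
Qed.

Lemma path_rep_rel x : cox_rel x -> path_rep x = 0.
Proof.
case=> i j m ij E.
rewrite (@path_rep_corner_eval (gen i j * gen j i)).
  by rewrite (gen_root ij E) raddf0.
apply: etrans (path_repM _ _) _.
apply: etrans (congr2 *%R (path_rep_edge ij) (path_rep_edge (cox_edgeC ij))) _.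
by apply: etrans (entry_mxM _ _ _ _ _ _) _; rewrite eqxx.
Qed.

End PathRep.

(** * Normal forms of paths *)

Section PathWords.
Variables (N : nat) (M : coxeter_matrix N).
Implicit Types (i j l : 'I_N) (s t : seq 'I_N).
Local Notation edge := (cox_edge M).
Local Notation T := ('I_N * 'I_N)%type.
Local Notation P := (path_alg edge).
Local Notation V := (free_alg rat T).

Fixpoint path_word i s : seq T :=
  if s is j :: t then uedge i j :: path_word j t else [::].

(** Read backwards from the common terminus, each undirected edge determines the preceding vertex,
    by [uedge_injl]. *)
Lemma path_word_inj i j s t : last i s = last j t ->
  path_word i s = path_word j t -> (i, s) = (j, t).
Proof.
elim: s i j t => [|k s IH] i j [|h t] //=; first by move=> ->.
by move=> E [+ /(IH _ _ _ E) [kh ->]]; rewrite kh => /uedge_injl ->.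
Qed.

(** The path (y_ij y_ji)^k followed by [s], a path from i. *)
Definition zigzag i j k s := iter k (fun t => [:: j, i & t]) s.

Lemma zigzag_last i j k s : last i (zigzag i j k s) = last i s.
Proof. by elim: k. Qed.

Lemma zigzag_path i j k s : edge i j -> path edge i s ->
  path edge i (zigzag i j k s).
Proof. by move=> ij si; elim: k => //= k ->; rewrite ij cox_edgeC. Qed.

Lemma zigzag_word i j k s :
  path_word i (zigzag i j k s) = nseq k.*2 (uedge i j) ++ path_word i s.
Proof. by elim: k => //= k ->; rewrite (uedgeC j i). Qed.

(** A path that stays on one undirected edge can only go back and forth, and after an odd number of
    steps from j it is at i. *)
Lemma path_word_zigzag i j k s w :
  path_word j s = nseq k.*2.+1 (uedge i j) ++ w ->
  exists2 t, s = i :: zigzag i j k t & path_word i t = w.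
Proof.
elim: k s => [|k IH] [|h s] //=.
  by rewrite uedgeC => -[/uedge_injl -> E]; exists s.
rewrite uedgeC => -[/uedge_injl -> {h}].
case: s => [|h s] //= [E].
have -> : h = j by apply: (@uedge_injl _ i); rewrite !(uedgeC _ i).
by case/IH => t -> tE; exists t.
Qed.

(** Made total, with value 0 off the paths, so that its terms contain no proof that [s] is a
    path. *)
Definition path_vec i s : P :=
  if insub (i, s) is Some p then cata (p : dpath edge) else 0.

Lemma path_vecE (p : dpath edge) : path_vec (val p).1 (val p).2 = cata p.
Proof. by rewrite /path_vec -surjective_pairing valK. Qed.

Lemma cata_path (p q r : dpath edge) : pterminus p = porigin q ->
  pconcat p q = r -> (cata p : P) * cata q = cata r.
Proof. by move=> pq <-; rewrite [LHS]cataM ifT //; apply/eqP. Qed.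

Lemma path_vec_cons i j s (ij : edge i j) : path edge j s ->
  pa_edge ij * path_vec j s = path_vec i (j :: s).
Proof.
move=> js; pose p : dpath edge := exist _ (j, s) js.
have jp : pterminus (pedge ij) = porigin p by [].
have -> : path_vec j s = cata p by exact: (path_vecE p).
rewrite [LHS](cata_path jp erefl).
by rewrite -path_vecE [val _](val_pconcat jp).
Qed.

Lemma vertex_path_vec i s : path edge i s ->
  pa_vertex edge i * path_vec i s = path_vec i s.
Proof.
move=> si; pose p : dpath edge := exist _ (i, s) si.
have -> : path_vec i s = cata p by exact: (path_vecE p).
have ip : pterminus (pvertex edge i) = porigin p by [].
rewrite /pa_vertex; exact: (cata_path ip (pconcat1p p)).
Qed.

Section NormalForm.
Variables (B : pzRingType) (pi : {rmorphism P -> B}).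
Hypothesis pi_rel : forall x, cox_rel x -> pi x = 0.

(* [nf i l v q]: the image q in R of an integral combination of paths from i
   to l, together with the same combination v of their edge words. *)
Inductive nf i l : V -> B -> Prop :=
| nf_path s of path edge i s & last i s = l :
    nf i l (wvec (path_word i s)) (pi (path_vec i s))
| nf0 : nf i l 0 0
| nfB v v' q q' of nf i l v q & nf i l v' q' : nf i l (v - v') (q - q').

Lemma nfN i l v q : nf i l v q -> nf i l (- v) (- q).
Proof. by move=> h; rewrite -[- v]sub0r -[- q]sub0r; apply/nfB/h/nf0. Qed.

Lemma nfD i l v v' q q' : nf i l v q -> nf i l v' q' ->
  nf i l (v + v') (q + q').
Proof.
by move=> h /nfN h'; rewrite -[v']opprK -[q']opprK; apply: nfB.
Qed.

Lemma nfMz i l v q n : nf i l v q -> nf i l (v *~ n) (q *~ n).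
Proof.
move=> h; have nfMn k : nf i l (v *+ k) (q *+ k).
  by elim: k => [|k IH]; [apply: nf0 | rewrite !mulrS; apply: nfD].
case: n => k; first by rewrite -!pmulrn.
by rewrite !NegzE !mulrNz -!pmulrn; apply: nfN.
Qed.

Lemma nf_sum i l (I : Type) (r : seq I) (Q : pred I) (v : I -> V) (q : I -> B) :
  (forall k, Q k -> nf i l (v k) (q k)) ->
  nf i l (\sum_(k <- r | Q k) v k) (\sum_(k <- r | Q k) q k).
Proof.
move=> h; elim: r => [|k r IH]; first by rewrite !big_nil; apply: nf0.
by rewrite !big_cons; case: ifP => // Qk; apply: nfD => //; apply: h.
Qed.

Lemma pi_path_cons i j s (ij : edge i j) : path edge j s ->
  pi (pa_edge ij) * pi (path_vec j s) = pi (path_vec i (j :: s)).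
Proof.
move=> js.
exact: etrans (esym (rmorphM pi _ _)) (congr1 pi (path_vec_cons ij js)).
Qed.

Lemma pi_zigzag i j k s (ij : edge i j) : path edge i s ->
  pi (path_vec i (zigzag i j k s)) =
  (pi (pa_edge ij) * pi (pa_edge (cox_edgeC ij))) ^+ k * pi (path_vec i s).
Proof.
move=> si; elim: k => [|k IH]; first by rewrite expr0 mul1r.
have zp := zigzag_path k ij si.
rewrite exprS -mulrA -IH -mulrA.
have jp : path edge j (i :: zigzag i j k s) by rewrite /= cox_edgeC.
apply: etrans (esym (pi_path_cons ij jp)) _; apply: (congr1 ( *%R _)).
exact: esym (pi_path_cons (cox_edgeC ij) zp).
Qed.

Lemma pi_corner_eval i p (z : P) :
  pi (corner_eval i p z) = pi (pa_vertex edge i) * int_eval p (pi z).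
Proof.
rewrite /corner_eval [LHS]raddf_sum mulr_sumr; apply: eq_bigr => k _.
rewrite -[p`_k in LHS]intz scaler_int [LHS]raddfMz [RHS]mulrzAr.
by congr (_ *~ _); apply: etrans (rmorphM pi _ _) _; rewrite rmorphXn.
Qed.

(** This is the relation C_m(y_ij y_ji) multiplied on the right by the path [s]. *)
Lemma zigzag_root i j m s : edge i j -> M i j = Some m -> path edge i s ->
  \sum_(k < size (cos_poly m))
    pi (path_vec i (zigzag i j k s)) *~ (cos_poly m)`_k = 0.
Proof.
move=> ij E si.
have := congr1 ( *%R^~ (pi (path_vec i s))) (pi_rel (CoxRel ij E)).
rewrite mul0r pi_corner_eval; apply: etrans.
have -> : pi (pa_edge ij * pa_edge (cox_edgeC ij)) =
  pi (pa_edge ij) * pi (pa_edge (cox_edgeC ij)) by exact: (rmorphM pi).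
rewrite /int_eval mulr_sumr mulr_suml.
apply: eq_bigr => k _; rewrite mulrzAr mulrzAl; congr (_ *~ _).
rewrite -mulrA -pi_zigzag //; apply: esym.
have zp := zigzag_path k ij si.
exact: etrans (esym (rmorphM pi _ _)) (congr1 pi (vertex_path_vec zp)).
Qed.

(** The heart of the comparison. For a single path, either no block is completed and the path just
    gets longer, or the new path starts with (y_ij y_ji)^d, d = deg C_m, and the relation in R
    performs the rewriting done by [run_op]. *)
Lemma nf_step i j l v q (ij : edge i j) : nf j l v q ->
  nf i l (edge_op M (uedge i j) v) (pi (pa_edge ij) * q).
Proof.
move=> h; elim: h => {v q} [s js sl||v v' q q' _ IH _ IH'].
- rewrite run_opE; case: ifP => [|_].
    rewrite /run_full /run_red edge_poly_uedge.
    (* For an infinite label the polynomial is 0 and a run is never full. *)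
    case E : (M i j) => [m|]; last by rewrite size_poly0.
    have m3 : (2 < m)%N by move: (ij) => /andP[_]; rewrite E.
    have m0 : (0 < m)%N by apply: leq_trans m3.
    have sz := cos_poly_size m0; have := zigzag_root ij E.
    have := cos_poly_monic m0; rewrite monicE lead_coefE.
    case: (size _) sz => [|[|d]] //= _ /eqP lead1 root /eqP [full].
    (* Here [d] is the degree of C_m minus one: the completed block has 2d + 2 letters, and 2d + 1
       of them lead the word of [s]. *)
    have le : (d.*2.+1 <= lead_run (uedge i j) (path_word j s))%N.
      by rewrite -full leq_mod.
    have [t sE tE] := path_word_zigzag (lead_run_split le).
    rewrite -tE; move: js sl; rewrite sE => js; rewrite (pi_path_cons ij js).
    have it : path edge i t.
      by move: js => /= /andP[_]; elim: (d) => //= n IH /and3P[_ _ /IH].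
    rewrite /= zigzag_last => tl.
    (* Since C_m is monic, its top term is exactly the new path, which therefore equals minus the
       sum of the lower zigzags. *)
    have := root t it; rewrite big_ord_recr /= lead1 mulr1z => /eqP.
    rewrite addrC addr_eq0 => /eqP ->; apply/nfN/nf_sum => k _.
    rewrite scaler_int -zigzag_word; apply: nfMz; apply: nf_path.
      exact: zigzag_path.
    by rewrite zigzag_last.
  rewrite (pi_path_cons ij js).
  by apply: (@nf_path i l (j :: s)); rewrite /= ?ij.
- by rewrite raddf0 mulr0; apply: nf0.
by rewrite raddfB mulrBr; apply: nfB.
Qed.

Definition word_coef (p : dpath edge) (c : int) : V :=
  c%:~R *: wvec (path_word (val p).1 (val p).2).

Lemma word_coefB p : zmod_morphism (word_coef p).
Proof. by move=> a b; rewrite /word_coef rmorphB scalerBl. Qed.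

(** Collects the whole combination into one element of the path algebra; of its paths only the
    terminus is recorded, as [path_word_inj] asks for nothing else. *)
Lemma nf_ex i l v q : nf i l v q -> exists g : P,
  [/\ forall p : dpath edge, mcoeff p g != 0 -> pterminus p = l,
      pi g = q & malg_sum word_coef g = v].
Proof.
elim=> {v q} [s si sl||v v' q q' _ [g [gl gq gv]] _ [h [hl hq hv]]].
- pose p : dpath edge := exist _ (i, s) si.
  have -> : path_vec i s = cata p by exact: (path_vecE p).
  exists (cata p); split=> //; last first.
    by rewrite /cata (malg_sumU word_coefB) /word_coef scale1r.
  move=> p'; rewrite /cata mcoeffU; have [<-|_] := eqVneq p p'; first by [].
  by rewrite mulr0n eqxx.
- exists 0; split; first by move=> p; rewrite mcoeff0 eqxx.
    exact: raddf0.
  exact: malg_sum0.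
exists (g - h); split.
- move=> p; rewrite mcoeffB; have [->|/gl //] := eqVneq (mcoeff p g) 0.
  by rewrite sub0r oppr_eq0 => /hl.
- by rewrite -gq -hq; apply: raddfB.
by rewrite (malg_sumB word_coefB) gv hv.
Qed.

(** Distinct paths ending at l have distinct edge words, so each coefficient of the combination [g]
    is a coefficient of its image 0; hence g = 0. *)
Lemma nf_inj i l q : nf i l 0 q -> q = 0.
Proof.
case/nf_ex => g [gl <- g0]; have -> : g = 0; last exact: raddf0.
apply/malgP => p; rewrite mcoeff0; apply/eqP; apply: contraTT isT => gp.
have /(congr1 (mcoeff (path_word (val p).1 (val p).2 : words T))) := g0.
rewrite mcoeff0 /malg_sum raddf_sum (bigD1_seq p) ?fset_uniq //=; last first.
  by rewrite -mcoeff_neq0.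
rewrite big1_seq => [|p' /andP[ne p'g]].
  rewrite addr0 /word_coef mcoeffZ mcoeffUU mulr1 => /eqP.
  by rewrite intr_eq0 (negPf gp).
rewrite /word_coef mcoeffZ mcoeffU; case: eqP => [E|]; last by rewrite mulr0.
case/eqP: ne; apply: val_inj.
rewrite [LHS]surjective_pairing [RHS]surjective_pairing.
apply: path_word_inj E; rewrite -/(pterminus p) -/(pterminus p').
by rewrite (gl p) // (gl p') // mcoeff_neq0.
Qed.

End NormalForm.
End PathWords.

(** * Injectivity of the matrix representation *)

Section Injectivity.
Variables (N : nat) (M : coxeter_matrix N).
Local Notation edge := (cox_edge M).
Local Notation T := ('I_N * 'I_N)%type.
Local Notation P := (path_alg edge).
Variables (B : pzRingType) (pi : {rmorphism P -> B}).
Hypothesis pi_rel : forall x, cox_rel x -> pi x = 0.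
Variables (A : pzRingType) (gen : 'I_N -> 'I_N -> A).
Variable rho : {rmorphism A -> word_endo T}.
Hypothesis rhoE : forall i j, edge i j -> rho (gen i j) = edge_op M (uedge i j).

(** By induction along the path: the generator of each edge acts by the operator that [nf_step]
    matches with left multiplication by that edge. *)
Lemma nf_path_gen i s : path edge i s ->
  nf pi i (last i s) (rho (path_gen gen i s) (wvec [::])) (pi (path_vec M i s)).
Proof.
elim: s i => [|j s IH] i.
  by move=> _; rewrite /= rmorph1; apply: (@nf_path _ _ _ pi i i [::]).
move=> /= /andP[ij js]; rewrite rmorphM (rhoE ij) -(pi_path_cons _ ij js).
by apply: nf_step => //; apply: IH.
Qed.

(** The part of x between two given vertices is treated by itself: its matrix entry is 0, hence acts
    as 0 on the empty word, and [nf_inj] applies. *)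
Lemma path_rep_ker (x : P) : path_rep gen x = 0 -> pi x = 0.
Proof.
move=> x0.
pose Q i l (p : dpath edge) := (porigin p == i) && (pterminus p == l).
have part i l : \sum_(p <- msupp x | Q i l p) pi (cata p) *~ mcoeff p x = 0.
  apply: (@nf_inj _ _ _ pi i l).
  (* Evaluation at the empty word turns the matrix entry into the rational vector that [nf] attaches
     to this part of x. *)
  pose ev (a : A) := rho a (wvec [::]).
  have evD : {morph ev : a b / a + b} by move=> a b; rewrite /ev rmorphD.
  have ev0 : ev 0 = 0 by rewrite /ev rmorph0.
  have evMz n : {morph ev : a / a *~ n}.
    by move=> a; rewrite /ev raddfMz -[n]intz -!scaler_int intz.
  have E : \sum_(p <- msupp x | Q i l p)
      ev (path_gen gen (val p).1 (val p).2) *~ mcoeff p x = 0.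
    transitivity (ev (path_rep gen x (mx_idx i) (mx_idx l))); last first.
      by rewrite x0 mxE ev0.
    rewrite /path_rep /malg_sum summxE (big_morph _ evD ev0).
    rewrite big_mkcond; apply: eq_bigr => p _; rewrite mxE !mx_idx_eq.
    rewrite /Q [i == _]eq_sym [l == _]eq_sym.
    by case: ifP => _; rewrite ?ev0 ?evMz.
  rewrite -E; apply: nf_sum => p /andP[/eqP pE /eqP pl]; apply: nfMz.
  rewrite -path_vecE -pl -[i]pE; exact: (nf_path_gen (valP p)).
rewrite [x]cata_sum raddf_sum.
transitivity (\sum_(p <- msupp x) pi (cata p) *~ mcoeff p x).
  apply: eq_bigr => p _; rewrite -[mcoeff p x in LHS]intz scaler_int.
  exact: raddfMz.
(* The parts, over all pairs of origin and terminus, add up to x. *)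
rewrite (partition_big
  (fun p : dpath edge => (porigin p, pterminus p)) predT) //=.
apply: big1 => -[i l] _; rewrite -[RHS](part i l).
by apply: eq_bigl => p; rewrite xpair_eqE.
Qed.

End Injectivity.

Theorem mainTheorem2 (N : nat) (M : coxeter_matrix N) :
  exists f : cox_ring M -> 'M[cox_coprod M]_N.+1,
    [/\ {morph f : x y / x + y}, {morph f : x y / x * y} & injective f].
Proof.
have [rho rhoE] := edge_op_rep M.
have [f [fB fM fE]] := ring_quot_lift (G := @cox_rel N M)
  (path_repB (edge_gen M)) (path_repM (edge_gen M))
  (path_rep_rel (@edge_gen_root N M)).
have f0 : f 0 = 0 by rewrite -(subrr 0) fB subrr.
have fN x : f (- x) = - f x by rewrite -[- x]sub0r fB f0 sub0r.
exists f; split=> // [x y|x y].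
  by rewrite -[y in LHS]opprK fB fN opprK.
move=> fxy; apply/eqP; rewrite -subr_eq0; apply/eqP.
have : f (x - y) = 0 by rewrite fB fxy subrr.
have [z ->] := rq_surj (x - y); rewrite fE.
(* The morphism of [path_rep_ker] is the projection onto R; it remains to see that it kills the
   relations. *)
apply: (path_rep_ker _ rhoE) => u /gen_ideal_in Iu.
by apply/eqP; rewrite -(raddf0 (rq_pi _)); apply/eqP/rq_piP; rewrite subr0.
Qed.
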